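(* There are universal constants $K_1,K_2>0$ such that the following holds. Let $c_0(x)$, $x\ge 0$, be a non-negative function with $\int_0^\infty x\,c_0(x)\,dx=1$ and $$\int_0^\infty (1+x^{4/3})\,c_0(x)\,dx=M_0<\infty .$$ Let $0<\varepsilon\le 1$ and let $c_\varepsilon(x,t)$ be the solution of the diffusive LSW system with initial data $c_\varepsilon(x,0)=c_0(x)$, $x\ge 0$. Put $E_\varepsilon(t)=\int_0^\infty x^{2/3}c_\varepsilon(x,t)\,dx$. Then $$\left[\frac1T\int_0^T E_\varepsilon(t)^2\,dt\right]^{-3/2}\le K_1T,$$ provided $T\ge K_2M_0^3$.
   Context: Diffusive LSW system with parameter $\varepsilon>0$ and initial data $c_0\ge 0$ (with $\int_0^\infty(1+x)c_0(x)dx<\infty$, $\int_0^\infty xc_0(x)dx=1$): the unknowns are a continuous function $L_\varepsilon:[0,\infty)\to(0,\infty)$ and a nonnegative function $c_\varepsilon(x,t)$ satisfying $$\frac{\partial c_\varepsilon}{\partial t}=\frac{\partial^2}{\partial x^2}\left[\varepsilon\left(1+\frac{x}{\varepsilon}\right)^{1/3}c_\varepsilon\right]+\frac{\partial}{\partial x}\left[\left\{1-\left(\frac{x}{L_\varepsilon(t)}\right)^{1/3}\right\}c_\varepsilon\right],\quad x>0,\ t>0,$$ the Dirichlet condition $c_\varepsilon(0,t)=0$, $t>0$, the initial condition $c_\varepsilon(\cdot,0)=c_0$ (attained in $L^1(0,\infty)$ as $t\to0^+$), and the conservation law $\int_0^\infty x\,c_\varepsilon(x,t)\,dx=1$, $t\ge0$.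 The conservation law corresponds to $L_\varepsilon(t)^{1/3}=\int_0^\infty x^{1/3}c_\varepsilon(x,t)dx\big/\int_0^\infty c_\varepsilon(x,t)dx$. The system has a unique global solution. *)

(* Defs.v *)
From HB Require Import structures.
From mathcomp Require Import all_boot all_order all_algebra.
From mathcomp Require Import all_classical all_reals all_analysis.
Set Implicit Arguments.
Unset Strict Implicit.
Unset Printing Implicit Defensive.
Import Order.TTheory GRing.Theory Num.Theory.
Import numFieldNormedType.Exports.
Local Open Scope classical_set_scope.
Local Open Scope ring_scope.

(** The diffusive Lifschitz-Slyozov-Wagner (LSW) system. A density is a function
    [c : R -> R -> R], read as [c x t] with [x] the size and [t] the time; only
    its values for [0 <= x] and [0 <= t] matter. *)

(** Classical regularity: [C^{2,1}] in the open quadrant, jointly continuous up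
    to the boundary [x = 0] for positive times, so that the Dirichlet condition
    is attained continuously. *)
Definition classical_regularity (R : realType) (c : R -> R -> R) : Prop :=
  [/\ {within [set z : R * R | 0 <= z.1 /\ 0 < z.2],
        continuous (fun z : R * R => c z.1 z.2)},
      forall x t : R, 0 < x -> 0 < t ->
        [/\ derivable (c x) t 1,
            derivable (fun y => c y t) x 1 &
            derivable (derive1 (fun y => c y t)) x 1] &
      forall z : R * R, 0 < z.1 -> 0 < z.2 ->
        [/\ {for z, continuous (fun w : R * R => derive1 (c w.1) w.2)},
            {for z, continuous (fun w : R * R => derive1 (fun y => c y w.2) w.1)} &
            {for z, continuous (fun w : R * R => derive1n 2 (fun y => c y w.2) w.1)}]].

Definition diffusive_LSW_equation (R : realType) (eps : R)
    (L : R -> R) (c : R -> R -> R) : Prop :=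
  forall x t : R, 0 < x -> 0 < t ->
    derive1 (c x) t =
      derive1n 2 (fun y => eps * (1 + y / eps) `^ (1 / 3) * c y t) x
      + derive1 (fun y => (1 - (y / L t) `^ (1 / 3)) * c y t) x.

Record diffusive_LSW_solution (R : realType) (eps : R) (c0 : R -> R)
    (L : R -> R) (c : R -> R -> R) : Prop := DiffusiveLSWSolution {
  LSW_L_continuous : {within `[0, +oo[, continuous L} ;
  LSW_L_gt0 : forall t : R, 0 <= t -> 0 < L t ;
  LSW_c_ge0 : forall x t : R, 0 <= x -> 0 <= t -> 0 <= c x t ;
  LSW_c_regular : classical_regularity c ;
  LSW_equation : diffusive_LSW_equation eps L c ;
  LSW_dirichlet : forall t : R, 0 < t -> c 0 t = 0 ;
  LSW_initial : forall x : R, 0 <= x -> c x 0 = c0 x ;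
  LSW_initial_L1 :
    (\int[lebesgue_measure]_(x in `]0%R, +oo[) (`|c x t - c0 x|)%:E)%E
      @[t --> 0^'+] --> 0%E ;
  LSW_conservation : forall t : R, 0 <= t ->
    (\int[lebesgue_measure]_(x in `[0%R, +oo[) (x * c x t)%:E = 1)%E
}.

Definition LSW_energy (R : realType) (c : R -> R -> R) (t : R) : \bar R :=
  (\int[lebesgue_measure]_(x in `[0%R, +oo[) (x `^ (2 / 3) * c x t)%:E)%E.

Definition LSW_mean_square_energy (R : realType) (c : R -> R -> R) (T : R)
    : \bar R :=
  ((T^-1)%:E *
     \int[lebesgue_measure]_(t in `[0%R, T]) (LSW_energy c t ^+ 2))%E.

(* Main.v *)
Require Import Defs.
From HB Require Import structures.
From mathcomp Require Import all_boot all_order all_algebra.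
From mathcomp Require Import all_classical all_reals all_analysis.
From mathcomp Require Import measurable_realfun ring lra.
Import Order.TTheory GRing.Theory Num.Theory.
Import numFieldNormedType.Exports.
Local Open Scope classical_set_scope.
Local Open Scope ring_scope.
Set Implicit Arguments.
Unset Strict Implicit.
Unset Printing Implicit Defensive.

(** Kohn-Otto scheme for an upper coarsening bound. For small k let
    E = int phi_k c, where phi_k(x) = (3/2) ((k + x)^(2/3) - k^(2/3)) is a smooth
    version of (3/2) x^(2/3), and M = int psi c, where psi is a C^2 function
    comparable to x^(4/3) at infinity. Mass conservation makes the mean drift
    vanish, so E' = - D with D = int d c and d >= 0, while a pointwise comparison
    of the weights gives M' <= (3 + 1/(4E^2)) D + 16 E^2 as soon as k <= L. Hence
    M + 3E - 1/(4E) - 16 int E^2 is nonincreasing. With the interpolation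
    inequality 1 <~ E (1 + M), itself a consequence of int x c = 1, this bounds
    1/E by 68 y, where y = M0 + int_0^t E^2. Therefore y' = E^2 >= (68 y)^(-2), and
    integrating, y(T) >= T^(1/3)/16, which is the claim once T^(1/3) dominates M0.
    The weak formulation is obtained from the classical one by integrating by
    parts on [s, N], letting s -> 0 with the Dirichlet condition, and then
    N -> oo; M itself need not be differentiable, so it is only used with a
    cutoff at N = n^3, at the price of an error 6 / n in M'. *)

(** The exact weight x^(2/3) is excluded as a test function: its derivatives blow up at 0, where
    only the continuity of c and the Dirichlet condition are known. The shift by [k] makes the
    weight smooth across 0, but beyond [x = L] the dissipation controls the drift only if the shift
    does not dominate, hence [k <= L]. Accordingly the horizon [T] is fixed first, and [k] is the
    smaller of 1 and the minimum of [L] on [0, T]; since no final constant depends on [k], no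
    uniform lower bound on [L] enters the result. The term 1/(4E) is dictated by E' = - D: its
    derivative D/(4E^2) is exactly the part of the bound on M' whose factor depends on E. It costs
    1/4 in the interpolation, where 1/2 is already lost, so that 1/4 of the mass remains. The
    pointwise inequalities are proved in cube-root variables, in which they become algebraic. *)

(* Extended by 0 to negative arguments, hence continuous on the whole line. *)
Definition cbrt (R : realType) (x : R) : R := (Num.max 0 x) `^ (1 / 3).

Lemma powR13 (R : realType) (x : R) : 0 <= x -> x `^ (1 / 3) = cbrt x.
Proof. by move=> x0; rewrite /cbrt max_r. Qed.

Lemma cbrt_ge0 (R : realType) (x : R) : 0 <= cbrt x.
Proof. exact: powR_ge0. Qed.

Lemma cbrt_gt0 (R : realType) (x : R) : 0 < x -> 0 < cbrt x.
Proof. by move=> x0; rewrite powR_gt0// lt_max x0 orbT. Qed.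

Lemma cbrtK (R : realType) (x : R) : 0 <= x -> cbrt x ^+ 3 = x.
Proof.
move=> x0; rewrite /cbrt max_r// -powR_mulrn ?powR_ge0// -powRrM.
by rewrite mul1r mulVf ?powRr1.
Qed.

Lemma powR23 (R : realType) (x : R) : 0 <= x -> x `^ (2 / 3) = cbrt x ^+ 2.
Proof.
move=> x0; rewrite /cbrt max_r// -powR_mulrn ?powR_ge0// -powRrM.
by congr (_ `^ _); lra.
Qed.

Lemma powR43 (R : realType) (x : R) : 0 <= x -> x `^ (4 / 3) = cbrt x ^+ 4.
Proof.
move=> x0; rewrite /cbrt max_r// -powR_mulrn ?powR_ge0// -powRrM.
by congr (_ `^ _); lra.
Qed.

Lemma ler_cbrt (R : realType) (x y : R) : x <= y -> cbrt x <= cbrt y.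
Proof.
move=> xy; apply: ge0_ler_powR; rewrite ?nnegrE.
- by rewrite divr_ge0.
- by rewrite le_max lexx.
- by rewrite le_max lexx.
- by rewrite ge_max !le_max lexx/= xy orbT.
Qed.

Lemma cbrt_uniq (R : realType) (x y : R) : 0 <= y -> y ^+ 3 = x -> cbrt x = y.
Proof.
move=> y0 <-; apply/eqP; rewrite -(@eqrXn2 _ 3)//; last exact: cbrt_ge0.
by rewrite cbrtK// exprn_ge0.
Qed.

Lemma cbrt_div (R : realType) (x y : R) : 0 <= x -> 0 < y ->
  cbrt (x / y) = cbrt x / cbrt y.
Proof.
move=> x0 y0; apply: cbrt_uniq; first by rewrite divr_ge0 ?cbrt_ge0.
by rewrite expr_div_n !cbrtK// ltW.
Qed.

Lemma cbrt_le_1x (R : realType) (x : R) : 0 <= x -> cbrt x <= 1 + x.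
Proof.
move=> x0; have [p1|p1] := leP (cbrt x) 1; first by lra.
have : cbrt x ^+ 1 <= cbrt x ^+ 3 by rewrite ler_weXn2l// ltW.
by rewrite cbrtK// expr1; lra.
Qed.

Lemma is_derive_cbrt (R : realType) (x : R) : 0 < x ->
  is_derive x 1 (@cbrt R) ((3 * cbrt x ^+ 2)^-1).
Proof.
move=> x0; have -> : (3 * cbrt x ^+ 2)^-1 = (1 / 3) * x `^ (1 / 3 - 1).
  rewrite -powR23 ?ltW// (_ : 1 / 3 - 1 = - (2 / 3)); last by lra.
  by rewrite powRN invfM mul1r.
apply: near_eq_is_derive (is_derive1_powR _ x0).
near=> y; rewrite powR13// ltW//.
by near: y; exact: lt_nbhsr.
Unshelve. all: by end_near. Qed.

Lemma continuous_cbrt (R : realType) : continuous (@cbrt R).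
Proof.
move=> x; case: (ltrP 0 x) => [x0|x0].
  apply: differentiable_continuous; apply/derivable1_diffP.
  by have [] := is_derive_cbrt x0.
have cx0 : @cbrt R x = 0.
  by rewrite /cbrt max_l// powR0// mul1r invr_neq0.
apply/cvgrPdist_le => e e0; near=> y.
rewrite cx0 sub0r normrN ger0_norm ?cbrt_ge0//.
rewrite -(@ler_pXn2r _ 3) ?nnegrE ?cbrt_ge0 ?(ltW e0)//.
have [y0|y0] := ltrP 0 y; last first.
  have ->: @cbrt R y = 0 by rewrite /cbrt max_l// powR0// mul1r invr_neq0.
  by rewrite expr0n; apply: exprn_ge0; exact: ltW.
rewrite cbrtK ?(ltW y0)//; near: y.
by apply: lt_le_nbhsl; rewrite (le_lt_trans x0)// exprn_gt0.
Unshelve. all: by end_near. Qed.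

(** * Pointwise comparison of the weights *)

Section pointwise.
Variable R : realType.
Implicit Types p l r d w E x a : R.

Lemma ler_cube (x y : R) : 0 <= y -> x ^+ 3 <= y ^+ 3 -> x <= y.
Proof.
move=> y0 xy; rewrite leNgt; apply/negP => yx.
suff : y ^+ 3 < x ^+ 3 by lra.
by rewrite ltr_pXn2r// nnegrE ltW// (le_lt_trans y0).
Qed.

Lemma cube_sqr_subadd d p r : 0 <= d -> 0 <= p -> r ^+ 3 = d ^+ 3 + p ^+ 3 ->
  r ^+ 2 <= d ^+ 2 + p ^+ 2.
Proof.
move=> d0 p0 h; apply: ler_cube; first by rewrite addr_ge0// exprn_ge0.
have -> : (r ^+ 2) ^+ 3 = (d ^+ 3 + p ^+ 3) ^+ 2 by rewrite -h; ring.
rewrite -subr_ge0.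
have -> : (d ^+ 2 + p ^+ 2) ^+ 3 - (d ^+ 3 + p ^+ 3) ^+ 2 =
  (d * p) ^+ 2 * (2 * d ^+ 2 + 2 * p ^+ 2 + (d - p) ^+ 2) by ring.
apply: mulr_ge0; first exact: sqr_ge0.
have := sqr_ge0 d; have := sqr_ge0 p; have := sqr_ge0 (d - p); lra.
Qed.

Lemma cube_subadd d p r : 0 <= d -> 0 <= p -> r ^+ 3 = d ^+ 3 + p ^+ 3 ->
  r <= d + p.
Proof.
move=> d0 p0 h; apply: ler_cube; first by rewrite addr_ge0.
rewrite h -subr_ge0.
have -> : (d + p) ^+ 3 - (d ^+ 3 + p ^+ 3) = 3 * d * p * (d + p) by ring.
by rewrite !mulr_ge0// addr_ge0.
Qed.

(** Here [d], [p], [l], [r], [m], [w] are the cube roots of [k], [x], [L], [k + x], [k + L],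
    [1 + x]; the left side is the drift part of M', the bracket the drift part of D. For [p <= l]
    the signs decide. For [p > l] the left side is at most 4/3 p (p - l) / l, and the two terms on
    the right, of sizes (p - l)^2 / (E^2 p l^2) and E^2 p^3, dominate it by the arithmetic-geometric
    inequality. *)
Lemma drift_pointwise d p l r m w E :
  0 < d -> d <= l -> 0 <= p -> 0 < r -> 0 < m ->
  r ^+ 3 = d ^+ 3 + p ^+ 3 -> m ^+ 3 = d ^+ 3 + l ^+ 3 ->
  0 < w -> w ^+ 3 = 1 + p ^+ 3 -> 0 < E ->
  - (4 / 3 * (w - 1) * (1 - p / l)) <=
  (4 * E ^+ 2)^-1 * ((r^-1 - m^-1) * (1 - p / l)) + 8 * E ^+ 2 * p ^+ 3.
Proof.
move=> d0 dl p0 r0 m0 hr hm w0 hw E0.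
have l0 : 0 < l by lra.
have w1 : 1 <= w.
  apply: ler_cube; first exact: ltW.
  by rewrite hw expr1n lerDl exprn_ge0.
have wp : w <= 1 + p by apply: cube_subadd => //; rewrite expr1n.
have [pl|lp] := lerP p l.
  have rm : r <= m.
    apply: ler_cube; first exact: ltW.
    by rewrite hr hm lerD2l lerXn2r// ?nnegrE// ltW.
  have q0 : 0 <= 1 - p / l by rewrite subr_ge0 ler_pdivrMr// mul1r.
  apply: (@le_trans _ _ 0).
    by rewrite oppr_le0 !mulr_ge0// subr_ge0.
  apply: addr_ge0; last by rewrite !mulr_ge0// ltW.
  apply: mulr_ge0; first by rewrite invr_ge0 mulr_ge0// sqr_ge0.
  by apply: mulr_ge0 => //; rewrite subr_ge0 lef_pV2 ?posrE.
have p1 : 0 < p by lra.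
(* The shift at most doubles the cube, and (4/3)^3 = 64/27 exceeds 2. This is where [d <= l]
   enters. *)
have cmp (u v z : R) : 0 < u -> u <= v -> 0 < z -> z ^+ 3 = u ^+ 3 + v ^+ 3 ->
    z <= 4 / 3 * v.
  move=> u0 uv z0 hz; apply: ler_cube; first by lra.
  rewrite hz; have : u ^+ 3 <= v ^+ 3 by rewrite lerXn2r ?nnegrE; lra.
  have v3 : 0 <= v ^+ 3 by rewrite exprn_ge0; lra.
  have -> : (4 / 3 * v) ^+ 3 = 64 / 27 * v ^+ 3 by field.
  by lra.
have rp : r <= 4 / 3 * p by apply: (cmp d) => //; lra.
have ml : m <= 4 / 3 * l by apply: (cmp d).
have rm : m <= r.
  apply: ler_cube; first exact: ltW.
  by rewrite hr hm lerD2l lerXn2r// ?nnegrE ltW.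
(* Since [r ^+ 3 - m ^+ 3 = p ^+ 3 - l ^+ 3], the two differences compare inversely to their
   quadratic cofactors; 9/16 is (3/4)^2. *)
have drm : 9 / 16 * (p - l) <= r - m.
  have e1 : (r - m) * (r ^+ 2 + r * m + m ^+ 2) =
            (p - l) * (p ^+ 2 + p * l + l ^+ 2).
    have -> : (r - m) * (r ^+ 2 + r * m + m ^+ 2) = r ^+ 3 - m ^+ 3 by ring.
    by rewrite hr hm; ring.
  have e2 : r ^+ 2 + r * m + m ^+ 2 <= 16 / 9 * (p ^+ 2 + p * l + l ^+ 2).
    have h1 : r * r <= (4 / 3 * p) * (4 / 3 * p) by rewrite ler_pM//; lra.
    have h2 : r * m <= (4 / 3 * p) * (4 / 3 * l) by rewrite ler_pM//; lra.
    have h3 : m * m <= (4 / 3 * l) * (4 / 3 * l) by rewrite ler_pM//; lra.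
    by rewrite !expr2; lra.
  have s0 : 0 < p ^+ 2 + p * l + l ^+ 2 by rewrite !addr_gt0 ?mulr_gt0 ?exprn_gt0.
  rewrite -(ler_pM2r s0) -[leLHS]mulrA -e1.
  have -> : 9 / 16 * ((r - m) * (r ^+ 2 + r * m + m ^+ 2)) =
    (r - m) * (9 / 16 * (r ^+ 2 + r * m + m ^+ 2)) by ring.
  by apply: ler_wpM2l; lra.
(* The factor 1/4 is a rounding of (9/16) / (16/9) = 81/256. *)
have ge : (p - l) ^+ 2 / (4 * p * l ^+ 2) <= (r^-1 - m^-1) * (1 - p / l).
  have -> : (r^-1 - m^-1) * (1 - p / l) = (r - m) * (p - l) / (r * m * l).
    by field; rewrite ?gt_eqF.
  rewrite ler_pdivrMr ?mulr_gt0 ?exprn_gt0//.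
  rewrite mulrAC ler_pdivlMr ?mulr_gt0//.
  have h1 : r * m * l <= 16 / 9 * (p * l ^+ 2).
    have : r * m <= (4 / 3 * p) * (4 / 3 * l) by rewrite ler_pM//; lra.
    by move=> /(ler_wpM2r (ltW l0)); rewrite expr2; lra.
  have h2 : 9 / 16 * (p - l) * (p - l) <= (r - m) * (p - l).
    by apply: ler_wpM2r => //; lra.
  have q0 : 0 <= p * l ^+ 2 by rewrite mulr_ge0 ?exprn_ge0//; lra.
  have s0 : 0 <= (p - l) ^+ 2 by rewrite sqr_ge0.
  have h3 := ler_wpM2l s0 h1.
  have h4 := ler_wpM2r q0 h2.
  have h5 : 0 <= (p - l) ^+ 2 * (p * l ^+ 2) by rewrite mulr_ge0.
  by rewrite !expr2 in h3 h4 h5 *; lra.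
apply: (@le_trans _ _ (4 / 3 * p * (p - l) / l)).
  have -> : - (4 / 3 * (w - 1) * (1 - p / l)) = 4 / 3 * (w - 1) * ((p - l) / l).
    by field; rewrite gt_eqF.
  rewrite -[leRHS]mulrA; apply: ler_wpM2r; last by lra.
  by rewrite divr_ge0//; lra.
apply: (@le_trans _ _ ((4 * E ^+ 2)^-1 * ((p - l) ^+ 2 / (4 * p * l ^+ 2)) +
                       8 * E ^+ 2 * p ^+ 3)); last first.
  rewrite lerD2r; apply: ler_wpM2l => //.
  by rewrite invr_ge0 mulr_ge0 ?sqr_ge0.
(* With A = (p - l) / (4 E l) and B = E p^2 this reads 16/3 A B <= A^2 + 8 B^2. *)
pose A := (p - l) / (4 * E * l); pose B := E * p ^+ 2.
have -> : 4 / 3 * p * (p - l) / l = (16 / 3 * (A * B)) / p.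
  by rewrite /A /B; field; rewrite ?gt_eqF.
have -> : (4 * E ^+ 2)^-1 * ((p - l) ^+ 2 / (4 * p * l ^+ 2)) +
          8 * E ^+ 2 * p ^+ 3 = (A ^+ 2 + 8 * B ^+ 2) / p.
  by rewrite /A /B; field; rewrite ?gt_eqF.
rewrite ler_pM2r ?invr_gt0//.
by have := sqr_ge0 (A - 8 / 3 * B); have := sqr_ge0 B; rewrite !expr2; lra.
Qed.

(** Here [a] is the diffusion coefficient, [w] and [r] are the cube roots of [1 + x] and [k + x].
    While [w ^+ 2 <= 2], the fixed multiple 3 of the dissipation suffices, because w^-2 >= 1/2 >=
    4/9: this is the origin of the term 3E in the functional. For larger [w] one has [a <= w <= x],
    and the arithmetic-geometric inequality with parameter [E] applies. *)
Lemma diffusion_pointwise x w r a E : 0 <= x -> 0 < r -> r <= w ->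
  w ^+ 3 = 1 + x -> 0 <= a -> a <= w -> 0 < E ->
  4 / 9 * w ^- 2 * a <=
  (3 + (4 * E ^+ 2)^-1) * (1 / 3 * r ^- 4 * a) + 8 * E ^+ 2 * x.
Proof.
move=> x0 r0 rw hw a0 aw E0.
have w0 : 0 < w by lra.
have w1 : 1 <= w.
  by apply: ler_cube; [exact: ltW|rewrite hw expr1n lerDl].
set v := w ^- 2.
have v0 : 0 < v by rewrite invr_gt0 exprn_gt0.
set e := (4 * E ^+ 2)^-1.
have e0 : 0 < e by rewrite invr_gt0 mulr_gt0 ?exprn_gt0.
have rv : v ^+ 2 <= r ^- 4.
  rewrite /v -exprVn -exprM /=.
  have wr : w^-1 <= r^-1 by rewrite lef_pV2.
  by rewrite -exprVn lerXn2r// nnegrE invr_ge0 ltW.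
apply: (@le_trans _ _ ((3 + e) * (1 / 3 * v ^+ 2 * a) + 8 * E ^+ 2 * x)); last first.
  rewrite lerD2r; apply: ler_wpM2l; first by lra.
  apply: ler_wpM2r => //; lra.
have [w2|w2] := lerP (w ^+ 2) 2.
  have v2 : 1 / 2 <= v.
    by rewrite /v -(@invrK _ 2) div1r lef_pV2 ?posrE ?invr_gt0 ?invrK// exprn_gt0.
  have h1 : (4 / 9 * v) * a <= (v * v) * a.
    by apply: ler_wpM2r => //; apply: ler_wpM2r; lra.
  have h2 : 0 <= e * (v ^+ 2 * a) by rewrite mulr_ge0 ?mulr_ge0 ?sqr_ge0 ?(ltW e0) ?(ltW v0).
  have h3 : 0 <= 8 * E ^+ 2 * x by rewrite mulr_ge0// mulr_ge0 ?sqr_ge0.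
  by rewrite !expr2 in h1 h2 h3 *; lra.
have ax : a <= x.
  apply: (le_trans aw).
  have : w * 2 <= w * w ^+ 2 by rewrite ler_wpM2l// ltW.
  by rewrite -exprS hw; lra.
have h1 : 4 / 9 * v <= e * (1 / 3 * v ^+ 2) + 8 * E ^+ 2.
  have -> : e = (E^-1 / 2) ^+ 2 by rewrite /e; field; rewrite gt_eqF.
  set f := E^-1.
  have ef : E * f = 1 by rewrite /f divff// gt_eqF.
  have := sqr_ge0 (f * v / 4 - 2 * E).
  have : 0 <= (f * v) ^+ 2 by rewrite sqr_ge0.
  have -> : (f * v / 4 - 2 * E) ^+ 2 =
    (f * v) ^+ 2 / 16 - v * (E * f) + 4 * E ^+ 2 by field.
  rewrite ef => h1 h2.
  have -> : (f / 2) ^+ 2 * (1 / 3 * v ^+ 2) = (f * v) ^+ 2 / 12 by field.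
  have := sqr_ge0 E; lra.
have h2 := ler_wpM2r a0 h1.
have h3 : 8 * E ^+ 2 * a <= 8 * E ^+ 2 * x.
  by apply: ler_wpM2l => //; rewrite mulr_ge0 ?sqr_ge0.
have h4 : 0 <= v ^+ 2 * a by rewrite mulr_ge0 ?sqr_ge0.
by lra.
Qed.

End pointwise.

(** * Test functions, cutoff and coefficients of the equation *)

Section C2_functions.
Variable R : realType.
Implicit Types (f g : R -> R) (x : R).

Let D f x d := is_derive x (1 : R) f d.

Lemma der_cst k x d : d = 0 -> D (fun=> k) x d.
Proof. by move=> ->; exact: is_derive_cst. Qed.

Lemma der_id x d : d = 1 -> D (fun y => y) x d.
Proof. by move=> ->; exact: is_derive_id. Qed.

Lemma der_add f g x df dg d : D f x df -> D g x dg -> d = df + dg ->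
  D (fun y => f y + g y) x d.
Proof. by move=> hf hg ->; exact: (is_deriveD hf hg). Qed.

Lemma der_sub f g x df dg d : D f x df -> D g x dg -> d = df - dg ->
  D (fun y => f y - g y) x d.
Proof. by move=> hf hg ->; exact: (is_deriveB hf hg). Qed.

Lemma der_mul f g x df dg d : D f x df -> D g x dg ->
  d = df * g x + f x * dg -> D (fun y => f y * g y) x d.
Proof.
move=> hf hg ->; apply: (is_derive_eq (is_deriveM hf hg)).
by rewrite !/GRing.scale/=; ring.
Qed.

Lemma der_exp f n x df d : D f x df -> d = n.+1%:R * f x ^+ n * df ->
  D (fun y => f y ^+ n.+1) x d.
Proof.
move=> hf; elim: n d => [|n IH] d ->.
  rewrite (_ : (fun y => f y ^+ 1) = f); last by apply/funext => y; rewrite expr1.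
  by rewrite expr0 !mul1r.
rewrite (_ : (fun y => f y ^+ n.+2) = fun y => f y * f y ^+ n.+1); last first.
  by apply/funext => y; rewrite exprS.
apply: der_mul hf (IH _ erefl) _.
by rewrite -!natr1 exprS; ring.
Qed.

Lemma der_inv f x df d : f x != 0 -> D f x df -> d = - (f x ^- 2 * df) ->
  D (fun y => (f y)^-1) x d.
Proof.
move=> f0 hf ->; apply: (is_derive_eq (is_deriveV f0 hf)).
by rewrite !/GRing.scale/= mulNr.
Qed.

Lemma der_comp f g x df dg d : D g x dg -> D f (g x) df -> d = df * dg ->
  D (fun y => f (g y)) x d.
Proof. by move=> hg hf ->; exact: (is_derive1_comp hf hg). Qed.

(** The derivatives are carried as explicit functions, so that product rules yield formulas. They
    are two-sided even at [x = 0], which the shifts in [phi] and [psi] permit. *)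
Definition C2_at f f1 f2 x := [/\ is_derive x (1 : R) f (f1 x),
  is_derive x (1 : R) f1 (f2 x) & {for x, continuous f2}].

Lemma is_derive_cts f (x df : R) : is_derive x (1 : R) f df -> {for x, continuous f}.
Proof.
by case=> fx _; apply: differentiable_continuous; apply/derivable1_diffP.
Qed.

Lemma C2_cts f f1 f2 x : C2_at f f1 f2 x ->
  [/\ {for x, continuous f}, {for x, continuous f1} & {for x, continuous f2}].
Proof. by case=> /is_derive_cts ? /is_derive_cts ?. Qed.

Lemma C2_mul f f1 f2 g g1 g2 x : C2_at f f1 f2 x -> C2_at g g1 g2 x ->
  C2_at (fun y => f y * g y) (fun y => f1 y * g y + f y * g1 y)
    (fun y => f2 y * g y + 2 * f1 y * g1 y + f y * g2 y) x.
Proof.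
move=> fC gC; have [cf cf1 cf2] := C2_cts fC; have [cg cg1 cg2] := C2_cts gC.
case: fC gC => [df df1 _] [dg dg1 _]; split.
- exact: der_mul df dg _.
- apply: der_add; [exact: der_mul df1 dg _|exact: der_mul df dg1 _|ring].
- apply: cvgD; first apply: cvgD.
  + exact: cvgM.
  + by apply: cvgM => //; apply: cvgM => //; exact: cvg_cst.
  + exact: cvgM.
Qed.

Lemma C2_subr f f1 f2 x k : C2_at f f1 f2 x ->
  C2_at (fun y => f y - k) f1 f2 x.
Proof.
case=> df df1 cf2; split => //.
by apply: der_sub df (der_cst k x erefl) _; rewrite subr0.
Qed.

Lemma C2_id x : C2_at id (cst 1) (cst 0) x.
Proof.
by split; [exact: is_derive_id|exact: is_derive_cst|exact: cst_continuous].
Qed.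

(* The cutoff and its derivative vanish at [N]: no boundary terms appear there. *)
Definition eta (N x : R) : R := (1 - x / N) ^+ 2.
Definition eta1 (N x : R) : R := - (2 / N) * (1 - x / N).
Definition eta2 (N x : R) : R := 2 / N ^+ 2.

Lemma C2_eta N x : C2_at (eta N) (eta1 N) (eta2 N) x.
Proof.
have d1 : D (fun y => 1 - y / N) x (- N^-1).
  apply: der_sub (der_cst 1 x erefl) (der_mul (der_id x erefl) (der_cst N^-1 x erefl) erefl) _.
  by ring.
split.
- by rewrite /eta; apply: der_exp d1 _; rewrite /eta1; ring.
- rewrite /eta1 /eta2; apply: der_mul (der_cst _ x erefl) d1 _.
  by rewrite -exprVn; ring.
- exact: cst_continuous.
Qed.

Lemma is_derive_cbrt_shift (k x : R) : 0 < k + x ->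
  is_derive x (1 : R) (fun y => cbrt (k + y)) ((3 * cbrt (k + x) ^+ 2)^-1).
Proof.
move=> kx.
apply: der_comp (der_add (der_cst k x erefl) (der_id x erefl) erefl)
  (is_derive_cbrt kx) _.
by rewrite add0r mulr1.
Qed.

Definition phi (k x : R) : R := 3 / 2 * (cbrt (k + x) ^+ 2 - cbrt k ^+ 2).
Definition phi1 (k x : R) : R := (cbrt (k + x))^-1.
Definition phi2 (k x : R) : R := - (1 / 3 * cbrt (k + x) ^- 4).

(** This is (1 + x)^(4/3) minus its first-order Taylor polynomial at 0. The value 0 at the origin is
    required by the weak form, and removing the slope makes [psi1] at most 4/3 x^(1/3), which the
    drift comparison uses for small sizes too. *)
Definition psi (x : R) : R := cbrt (1 + x) ^+ 4 - 1 - 4 / 3 * x.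
Definition psi1 (x : R) : R := 4 / 3 * (cbrt (1 + x) - 1).
Definition psi2 (x : R) : R := 4 / 9 * cbrt (1 + x) ^- 2.

Lemma C2_phi k x : 0 < k + x -> C2_at (phi k) (phi1 k) (phi2 k) x.
Proof.
move=> kx; have c0 := cbrt_gt0 kx.
have h := is_derive_cbrt_shift kx.
have hc := is_derive_cts h.
split.
- apply: der_mul (der_cst (3 / 2) x erefl)
    (der_sub (der_exp h erefl) (der_cst (cbrt k ^+ 2) x erefl) erefl) _.
  by rewrite /phi1; field; rewrite gt_eqF.
- apply: (der_inv (f := fun y => cbrt (k + y)) (lt0r_neq0 c0) h).
  by rewrite /phi2; field; rewrite gt_eqF.
- rewrite /phi2; apply: cvgN; apply: cvgM; first exact: cvg_cst.
  apply: cvgV; first by rewrite expf_neq0// lt0r_neq0.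
  exact: (cvgM hc (cvgM hc (cvgM hc hc))).
Qed.

Lemma C2_psi x : 0 < 1 + x -> C2_at psi psi1 psi2 x.
Proof.
move=> kx; have c0 := cbrt_gt0 kx.
have h := is_derive_cbrt_shift kx.
have hc := is_derive_cts h.
split.
- apply: der_sub (der_sub (der_exp h erefl) (der_cst 1 x erefl) erefl)
    (der_mul (der_cst (4 / 3) x erefl) (der_id x erefl) erefl) _.
  by rewrite /psi1; field; rewrite gt_eqF.
- apply: der_mul (der_cst (4 / 3) x erefl) (der_sub h (der_cst 1 x erefl) erefl) _.
  by rewrite /psi2; field; rewrite gt_eqF.
- rewrite /psi2; apply: cvgM; first exact: cvg_cst.
  apply: cvgV; first by rewrite expf_neq0// lt0r_neq0.
  exact: (cvgM hc hc).
Qed.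

Definition dif (e x : R) : R := e * (1 + x / e) `^ (1 / 3).
Definition dri (l x : R) : R := 1 - (x / l) `^ (1 / 3).

Lemma dif_derivable e x : 0 < e -> - e < x ->
  derivable (dif e) x (1 : R) /\ derivable (derive1 (dif e)) x (1 : R).
Proof.
move=> e0 ex.
have pos y : - e < y -> 0 < 1 + y / e.
  by move=> ey; rewrite -(divff (lt0r_neq0 e0)) -mulrDl divr_gt0//; lra.
have d1 y : D (fun y => 1 + y / e) y (e^-1).
  apply: der_add (der_cst 1 y erefl) (der_mul (der_id y erefl) (der_cst e^-1 y erefl) erefl) _.
  by ring.
have d2 (p : R) y : - e < y ->
    D (fun y => (1 + y / e) `^ p) y (p * (1 + y / e) `^ (p - 1) * e^-1).
  move=> ey; exact: der_comp (d1 y) (is_derive1_powR p (pos _ ey)) _.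
have d3 y : - e < y -> is_derive y (1 : R) (dif e) (1 / 3 * (1 + y / e) `^ (1 / 3 - 1)).
  move=> ey; apply: der_mul (der_cst e y erefl) (d2 (1 / 3) y ey) _.
  by field; rewrite gt_eqF.
split; first by case: (d3 x ex).
have d4 : is_derive x (1 : R) (fun y => 1 / 3 * (1 + y / e) `^ (1 / 3 - 1))
  (1 / 3 * ((1 / 3 - 1) * (1 + x / e) `^ (1 / 3 - 1 - 1) * e^-1)).
  apply: der_mul (der_cst (1 / 3) x erefl) (d2 (1 / 3 - 1) x ex) _.
  by ring.
suff : is_derive x (1 : R) (derive1 (dif e))
  (1 / 3 * ((1 / 3 - 1) * (1 + x / e) `^ (1 / 3 - 1 - 1) * e^-1)) by case.
apply: near_eq_is_derive d4; near=> y.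
have [] := d3 y; last by rewrite derive1E => _ ->.
by near: y; exact: lt_nbhsr.
Unshelve. all: by end_near. Qed.

Lemma dri_derivable l x : 0 < l -> 0 < x -> derivable (dri l) x (1 : R).
Proof.
move=> l0 x0.
have h := der_sub (der_cst 1 x erefl)
  (der_comp (der_mul (der_id x erefl) (der_cst l^-1 x erefl) erefl)
    (is_derive1_powR (1 / 3) (divr_gt0 x0 l0)) erefl) erefl.
by case: h.
Qed.

Lemma driE l x : 0 < l -> 0 <= x -> dri l x = 1 - cbrt x / cbrt l.
Proof.
by move=> l0 x0; rewrite /dri powR13 ?cbrt_div// divr_ge0// ltW.
Qed.

(** Cubing reduces the claim to e^3 + e^2 x <= 1 + x. Through this bound the later constants become
    independent of [eps]. *)
Lemma dif_le e x : 0 < e -> e <= 1 -> 0 <= x -> dif e x <= cbrt (1 + x).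
Proof.
move=> e0 e1 x0.
have xe : 0 <= x / e by rewrite divr_ge0// ltW.
rewrite /dif powR13; last by lra.
rewrite -(ler_pXn2r (isT : (0 < 3)%N)) ?nnegrE ?cbrt_ge0//; last first.
  by rewrite mulr_ge0 ?cbrt_ge0// ltW.
rewrite exprMn !cbrtK; [|lra|lra].
have -> : e ^+ 3 * (1 + x / e) = e ^+ 3 + e ^+ 2 * x by field; rewrite gt_eqF.
apply: lerD; first by rewrite exprn_ile1// ltW.
by rewrite ler_piMl// exprn_ile1// ltW.
Qed.

End C2_functions.

(** * Weak formulation *)

Lemma derivable_derive1 (R : realType) (f : R -> R) (x : R) :
  derivable f x 1 -> is_derive x (1 : R) f (derive1 f x).
Proof. by move=> fx; apply: DeriveDef; rewrite ?derive1E. Qed.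

Section compact_intervals.
Variable R : realType.
Notation mu := (@lebesgue_measure R).

Lemma cts_within (f : R -> R) a b : (forall x, a <= x <= b -> {for x, continuous f}) ->
  {within `[a, b], continuous f}.
Proof.
move=> h; apply: continuous_in_subspaceT => x.
by rewrite inE/= in_itv/= => /h.
Qed.

Lemma cts_integrable (f : R -> R) a b :
  (forall x, a <= x <= b -> {for x, continuous f}) ->
  mu.-integrable `[a, b] (EFin \o f).
Proof.
move=> h; apply: continuous_compact_integrable; first exact: segment_compact.
exact: cts_within.
Qed.

Lemma FTC2_is_derive (F f : R -> R) a b : a < b ->
  (forall x : R, a <= x <= b -> is_derive x (1 : R) F (f x)) ->
  (forall x, a <= x <= b -> {for x, continuous f}) ->
  \int[mu]_(x in `[a, b]) f x = F b - F a.
Proof.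
move=> ab dF cf.
have cF x : a <= x <= b -> {for x, continuous F} by move=> /dF/is_derive_cts.
rewrite /Rintegral (@continuous_FTC2 _ f F)//.
- exact: cts_within.
- split.
  + by move=> x; rewrite in_itv/= => /andP[? ?]; case: (dF x) => //; rewrite !ltW.
  + by apply: cvg_at_right_filter; apply: cF; rewrite lexx ltW.
  + by apply: cvg_at_left_filter; apply: cF; rewrite lexx ltW.
- move=> x; rewrite in_itv/= => /andP[? ?]; rewrite derive1E.
  by case: (dF x) => //; rewrite !ltW.
Qed.

Lemma cts_pairl (x t : R) : {for x, continuous (fun y : R => (y, t))}.
Proof.
move=> P [[U V]/= [hU hV] UV]; apply: filterS hU => y Uy; apply: UV; split => //=.
exact: nbhs_singleton.
Qed.

(** Compactness of the segment, in its near-covering form, turns joint continuity at each (x, t)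
    into closeness in time uniform in x. *)
Lemma tube (h : R * R -> R) (a b t e : R) : 0 < e ->
  (forall x, a <= x <= b -> {for (x, t), continuous h}) ->
  \forall t' \near t, forall x, a <= x <= b -> `|h (x, t') - h (x, t)| <= e.
Proof.
move=> e0 hc.
have cpt : near_covering `[a, b]%classic.
  by apply/compact_near_coveringP; exact: (@segment_compact R).
have := cpt R (nbhs t) (fun t' x => `|h (x, t') - h (x, t)| <= e) _.
case=> [x|r /= r0 hr].
  rewrite /= in_itv/= => /hc hx.
  have e2 : 0 < e / 2 by rewrite divr_gt0.
  move/cvgrPdist_le : hx => /(_ _ e2) [[U V]/= [Ux Vt] UV].
  exists (U, V) => //= -[y t']/= [Uy Vt'].
  have h1 : `|h (x, t) - h (y, t')| <= e / 2 by exact: UV.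
  have h2 : `|h (x, t) - h (y, t)| <= e / 2.
    by apply: UV; split => //=; exact: nbhs_singleton.
  rewrite (_ : h (y, t') - h (y, t) =
    (h (x, t) - h (y, t)) - (h (x, t) - h (y, t'))); last by ring.
  by rewrite (le_trans (ler_normB _ _))// [e in _ <= e]splitr lerD.
by exists r => //= t' /hr h' x xab; apply: h'; rewrite /= in_itv.
Qed.

Lemma cts_bounded (f : R -> R) a b : (forall x, a <= x <= b -> {for x, continuous f}) ->
  exists2 B, 0 < B & forall x, a <= x <= b -> `|f x| <= B.
Proof.
move=> cf; have [ab|ba] := leP a b; last first.
  by exists 1 => // x /andP[ax xb]; move: (le_trans ax xb); rewrite leNgt ba.
have cn : {within `[a, b], continuous (fun x => `|f x|)}.
  apply: cts_within => x /cf cx.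
  by apply: (continuous_comp cx); exact: norm_continuous.
have [m _ hm] := EVT_max ab cn.
exists (`|f m| + 1) => [|x xab]; first by rewrite ltr_wpDl.
by rewrite (le_trans (hm _ _)) ?in_itv// lerDl.
Qed.

(** Supplies the constant dominating function for differentiation under the integral sign. *)
Lemma tube_bounded (h : R * R -> R) (a b t : R) :
  (forall x, a <= x <= b -> {for (x, t), continuous h}) ->
  exists2 B, 0 < B &
  \forall t' \near t, forall x, a <= x <= b -> `|h (x, t')| <= B.
Proof.
move=> hc.
have [x /hc cx|B B0 hB] := @cts_bounded (fun x => h (x, t)) a b.
  exact: (continuous_comp (@cts_pairl x t) cx).
exists (B + 1); first by rewrite addr_gt0.
have := tube ltr01 hc; apply: filterS => t' ht x xab.
rewrite -[h _](subrK (h (x, t))) addrC (le_trans (ler_normD _ _))//.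
by rewrite lerD ?hB ?ht.
Qed.

End compact_intervals.

Section weak_form.
Variables (R : realType) (eps : R) (c0 L : R -> R) (c : R -> R -> R).
Hypothesis eps_gt0 : 0 < eps.
Hypothesis H : diffusive_LSW_solution eps c0 L c.
Notation mu := (@lebesgue_measure R).
Implicit Types (g f : R -> R) (x t s N : R).

(* Extended by the boundary value 0 to x < 0: continuous at every (x, t) with 0 < t. *)
Definition cx (z : R * R) : R := c (Num.max 0 z.1) z.2.

Lemma cxE x t : 0 <= x -> cx (x, t) = c x t.
Proof. by move=> x0; rewrite /cx/= max_r. Qed.

Lemma cx_ge0 x t : 0 < t -> 0 <= cx (x, t).
Proof. by move=> t0; apply: (LSW_c_ge0 H); rewrite ?le_max ?lexx// ltW. Qed.

(** The regularity hypothesis gives continuity only relative to the closed quadrant; clamping the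
    size at 0 maps a full neighbourhood of (x, t) into it. *)
Lemma cts_cx x t : 0 < t -> {for (x, t), continuous cx}.
Proof.
move=> t0; have [/subspace_continuousP + _ _] := LSW_c_regular H.
move=> /(_ (Num.max 0 x, t)) /=; rewrite le_max lexx => /(_ (conj isT t0)) hc.
apply: (cvg_comp (fun z : R * R => (Num.max 0 z.1, z.2)) _ _ hc).
move=> P [[U V]/= [hU hV] UV].
have cm : Num.max 0 z @[z --> x] --> Num.max 0 x.
  by apply: continuous_max => //; exact: cvg_cst.
near=> z => /=; apply: UV; split => //=.
- by near: z; exists ([set y | U (Num.max 0 y)], setT) => /=; [split; [exact: cm|exact: filterT]|move=> [y y'] /= []].
- by near: z; exists (setT, V) => /=; [split => //; exact: filterT|move=> [y y'] /= []].
- by rewrite le_max lexx.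
- by near: z; exists (setT, [set y | 0 < y]) => /=; [split; [exact: filterT|exact: lt_nbhsr]|move=> [y y'] /= []].
Unshelve. all: by end_near. Qed.

Lemma cts_cx_x x t : 0 < t -> {for x, continuous (fun y : R => cx (y, t))}.
Proof.
move=> t0.
exact: (@continuous_comp _ _ _ _ cx _ (@cts_pairl _ x t) (@cts_cx x t t0)).
Qed.

Lemma cts_ct x t : 0 < x -> 0 < t ->
  {for (x, t), continuous (fun w : R * R => derive1 (c w.1) w.2)}.
Proof.
by move=> x0 t0; have [_ _ /(_ (x, t))] := LSW_c_regular H; case.
Qed.

Lemma cts_c_x x t : 0 < x -> 0 < t -> {for x, continuous (fun y => c y t)}.
Proof.
move=> x0 t0; have [_ /(_ x t x0 t0)[_ h _] _] := LSW_c_regular H.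
by apply: differentiable_continuous; apply/derivable1_diffP.
Qed.

Lemma cts_ct_x x t : 0 < x -> 0 < t ->
  {for x, continuous (fun y => derive1 (c y) t)}.
Proof.
move=> x0 t0; exact: (continuous_comp (@cts_pairl _ x t) (cts_ct x0 t0)).
Qed.

(** The condition [g s = 0] removes the boundary term with the x-derivative of c at [s], over which
    there is no control as s -> 0. What survives contains c itself, and the Dirichlet condition will
    remove it. *)
Lemma weak_slice g g1 g2 s N t : 0 < s -> s < N -> 0 < t ->
  (forall x, s <= x <= N -> C2_at g g1 g2 x) ->
  g s = 0 -> g N = 0 -> g1 N = 0 ->
  \int[mu]_(x in `[s, N]) (g x * derive1 (c x) t) =
  g1 s * (dif eps s * c s t) +
  \int[mu]_(x in `[s, N]) ((g2 x * dif eps x - g1 x * dri (L t) x) * c x t).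
Proof.
move=> s0 sN t0 gC gs gN g1N.
have Lt : 0 < L t by apply: (LSW_L_gt0 H); exact: ltW.
pose u y := dif eps y * c y t; pose v y := dri (L t) y * c y t.
pose u1 y := derive1 (dif eps) y * c y t + dif eps y * derive1 (fun y => c y t) y.
have reg x : 0 < x -> [/\ derivable (c x) t 1, derivable (fun y => c y t) x 1 &
            derivable (derive1 (fun y => c y t)) x 1].
  by move=> x0; have [_ + _] := LSW_c_regular H; exact.
have D f x := @derivable_derive1 R f x.
have epsx x : 0 < x -> - eps < x by move=> x0; rewrite (lt_trans _ x0)// oppr_lt0.
have du x : 0 < x -> is_derive x (1 : R) u (u1 x).
  move=> x0; have [da _] := dif_derivable eps_gt0 (epsx _ x0).
  have [_ dc _] := reg x x0.
  by apply: der_mul (D _ _ da) (D _ _ dc) _.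
have u1E x : 0 < x -> derive1 u x = u1 x.
  by move=> /du[_ <-]; rewrite derive1E.
have du1 x : 0 < x -> derivable (derive1 u) x 1.
  move=> x0; have [da da1] := dif_derivable eps_gt0 (epsx _ x0).
  have [_ dc dc1] := reg x x0.
  have h := der_add (der_mul (D _ _ da1) (D _ _ dc) erefl)
    (der_mul (D _ _ da) (D _ _ dc1) erefl) erefl.
  have : derivable u1 x 1 by case: h.
  apply: near_eq_derivable; near=> y; rewrite u1E//.
  by near: y; exact: lt_nbhsr.
have dv x : 0 < x -> derivable v x 1.
  move=> x0; have [_ dc _] := reg x x0.
  have h := der_mul (D _ _ (dri_derivable Lt x0)) (D _ _ dc) erefl.
  by case: h.
have eqn x : 0 < x -> derive1 (c x) t = derive1 (derive1 u) x + derive1 v x.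
  by move=> x0; rewrite (LSW_equation H x0 t0) derive1nS.
(* One primitive performs both integrations by parts: the products of [g1] with the derivative of
   [u] cancel in the derivative of [W]. *)
pose W y := g y * derive1 u y - g1 y * u y + g y * v y.
pose k y := (g2 y * dif eps y - g1 y * dri (L t) y) * c y t.
pose f y := g y * derive1 (c y) t - k y.
have pos x : s <= x <= N -> 0 < x by move=> /andP[sx _]; lra.
have dW x : s <= x <= N -> is_derive x (1 : R) W (f x).
  move=> xsN; have x0 := pos x xsN; have [dg dg1 _] := gC x xsN.
  apply: der_add (der_sub (der_mul dg (D _ _ (du1 x x0)) erefl)
    (der_mul dg1 (du x x0) erefl) erefl) (der_mul dg (D _ _ (dv x x0)) erefl) _.
  rewrite /f /k eqn// u1E// /u /v; ring.
have ck x : s <= x <= N -> {for x, continuous k}.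
  move=> xsN; have x0 := pos x xsN; have [cg cg1 cg2] := C2_cts (gC x xsN).
  have [da _] := dif_derivable eps_gt0 (epsx _ x0).
  apply: cvgM; last exact: cts_c_x.
  apply: cvgB; apply: cvgM => //.
  - exact: is_derive_cts (D _ _ da).
  - exact: is_derive_cts (D _ _ (dri_derivable Lt x0)).
have cgc x : s <= x <= N -> {for x, continuous (fun x => g x * derive1 (c x) t)}.
  move=> xsN; have x0 := pos x xsN; have [cg cg1 cg2] := C2_cts (gC x xsN).
  by apply: cvgM => //; exact: cts_ct_x.
have cf x : s <= x <= N -> {for x, continuous f}.
  by move=> xsN; apply: cvgB; [exact: cgc|exact: ck].
have := FTC2_is_derive sN dW cf.
rewrite /f RintegralB//; [|exact: cts_integrable|exact: cts_integrable].
have -> : W N - W s = g1 s * (dif eps s * c s t).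
  by rewrite /W gs gN g1N /u; ring.
by move=> <-; rewrite subrK.
Unshelve. all: by end_near. Qed.

(** On [s, N] the time derivative of c is jointly continuous, hence bounded uniformly for times near
    [t]; differentiation under the integral then reduces the claim to [weak_slice]. *)
Lemma weak_deriv g g1 g2 s N t : 0 < s -> s < N -> 0 < t ->
  (forall x, s <= x <= N -> C2_at g g1 g2 x) ->
  g s = 0 -> g N = 0 -> g1 N = 0 ->
  is_derive t (1 : R) (fun t => \int[mu]_(x in `[s, N]) (g x * c x t))
    (g1 s * (dif eps s * c s t) +
     \int[mu]_(x in `[s, N]) ((g2 x * dif eps x - g1 x * dri (L t) x) * c x t)).
Proof.
move=> s0 sN t0 gC gs gN g1N.
have pos x : s <= x <= N -> 0 < x by move=> /andP[sx _]; lra.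
pose h (z : R * R) := g z.1 * derive1 (c z.1) z.2.
have ch x : s <= x <= N -> {for (x, t), continuous h}.
  move=> xsN; apply: cvgM; last exact: cts_ct (pos _ xsN) t0.
  have [cg _ _] := C2_cts (gC x xsN).
  exact: (@continuous_comp _ _ _ fst g (x, t) (@cvg_fst _ _ _ _ _) cg).
have [B B0 /= hB] := tube_bounded ch.
have [r r0 hr] : exists2 r : R, 0 < r & forall t', `]t - r, t + r[%classic t' ->
    0 < t' /\ forall x, s <= x <= N -> `|h (x, t')| <= B.
  have : \forall t' \near t, 0 < t' /\ forall x, s <= x <= N -> `|h (x, t')| <= B.
    by near=> t'; split; [near: t'; exact: lt_nbhsr|near: t'; exact: hB].
  case=> r /= r0 hr; exists r => // t'.
  rewrite /= in_itv/= => /andP[h1 h2]; apply: hr => /=.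
  by rewrite distrC ltr_distl h1 h2.
have tI : `]t - r, t + r[%classic t by rewrite /= in_itv/= ltrBlDr ltrDl r0.
have F1 t' : `]t - r, t + r[%classic t' ->
    mu.-integrable `[s, N] (EFin \o (fun x => g x * c x t')).
  move=> /hr[t'0 _]; apply: cts_integrable => x xsN.
  have [cg _ _] := C2_cts (gC x xsN).
  by apply: cvgM => //; exact: cts_c_x (pos _ xsN) t'0.
have F2 t' x : `]t - r, t + r[%classic t' -> `[s, N]%classic x ->
    is_derive t' (1 : R) (fun t' => g x * c x t') (g x * derive1 (c x) t').
  rewrite [X in _ -> X -> _]/= in_itv => /hr[t'0 _] /pos x0.
  have [_ /(_ x t' x0 t'0)[h1 _ _] _] := LSW_c_regular H.
  have h2 : is_derive t' (1 : R) (c x) (derive1 (c x) t').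
    exact: derivable_derive1.
  by apply: der_mul (der_cst (g x) t' erefl) h2 _; rewrite mul0r add0r.
have F3 t' x : `]t - r, t + r[%classic t' -> `[s, N]%classic x ->
    derivable (fun t' => g x * c x t') t' 1.
  by move=> h1 h2; case: (F2 t' x h1 h2).
have F4 t' x : `]t - r, t + r[%classic t' -> `[s, N]%classic x ->
    `|partial1of2 (fun t' x => g x * c x t') t' x| <= B.
  move=> h1 h2; rewrite partial1of2E; case: (F2 t' x h1 h2) => _ ->.
  by apply: (hr _ h1).2; move: h2; rewrite /= in_itv.
have F5 : mu.-integrable `[s, N] (EFin \o (fun=> B)).
  by apply: cts_integrable => x _; exact: cst_continuous.
have mI : measurable (`[s, N]%classic : set R) by exact: measurable_itv.
have B0' : forall y : R, 0 <= (fun=> B) y by move=> _; exact: ltW.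
apply: DeriveDef.
  exact (@derivable_under_integral R _ _ mu (fun t' x => g x * c x t') `[s, N]%classic
    mI t (t - r) (t + r) tI F1 F3 (fun=> B) B0' F5 F4).
rewrite -derive1E (@differentiation_under_integral R _ _ mu (fun t' x => g x * c x t')
  `[s, N]%classic mI t (t - r) (t + r) tI F1 F3 (fun=> B) B0' F5 F4).
rewrite -(@weak_slice g g1 g2 s N t)//; apply: eq_Rintegral => x.
by rewrite inE => xs; rewrite partial1of2E; case: (F2 t x tI xs).
Unshelve. all: by end_near. Qed.

End weak_form.

(** * Limits of integrals and of derivatives *)

Section integral_limits.
Variable R : realType.
Notation mu := (@lebesgue_measure R).
Implicit Types (f g h k u : R -> R) (D A : set (measurableTypeR R)).

Lemma integrable_dominated D f g : measurable D -> measurable_fun D f ->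
  mu.-integrable D (EFin \o g) -> (forall x, D x -> `|f x| <= g x) ->
  mu.-integrable D (EFin \o f).
Proof.
move=> mD mf ig fg; apply: le_integrable ig => //; first exact/measurable_EFinP.
by move=> x Dx /=; rewrite lee_fin (le_trans (fg x Dx))// ler_norm.
Qed.

(** Extending [f] by 0 outside [A] lets the single bound [k] control both the error on [A] and the
    part of [h] that is lost on the rest of [D]. *)
Lemma Rintegral_approx A D f h k : measurable A -> measurable D -> A `<=` D ->
  mu.-integrable A (EFin \o f) -> mu.-integrable D (EFin \o h) ->
  mu.-integrable D (EFin \o k) ->
  (forall x, A x -> `|f x - h x| <= k x) ->
  (forall x, D x -> ~ A x -> `|h x| <= k x) ->
  `|\int[mu]_(x in A) f x - \int[mu]_(x in D) h x| <= \int[mu]_(x in D) k x.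
Proof.
move=> mA mD AD fi hi ki fh hk.
have -> : \int[mu]_(x in A) f x = \int[mu]_(x in D) (f \_ A) x.
  by rewrite -Rintegral_mkcondr setIidr.
have fAi : mu.-integrable D (EFin \o (f \_ A)).
  by rewrite -restrict_EFin; apply/integrable_restrict => //; rewrite setIidr.
have di : mu.-integrable D (EFin \o (fun x => (f \_ A) x - h x)).
  exact: (integrableB mD fAi hi).
rewrite -RintegralB//; apply: le_trans (le_normr_Rintegral mD di) _.
apply: le_Rintegral => //; first exact: integrable_norm.
move=> x Dx; rewrite patchE; case: ifPn => [|]; first by rewrite inE => /fh.
by rewrite notin_setE => /hk; rewrite sub0r normrN; exact.
Qed.

Lemma trunc_cvg D u (w : nat -> R -> R) (A : nat -> set (measurableTypeR R)) :
  measurable D -> (forall n, measurable (A n)) -> (forall n, A n `<=` D) ->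
  mu.-integrable D (EFin \o u) ->
  (forall n, measurable_fun (A n) (w n)) ->
  (forall n x, A n x -> 0 <= w n x <= 1) ->
  (forall x, D x -> \forall n \near \oo, A n x) ->
  (forall x, D x -> w n x @[n --> \oo] --> (1 : R)) ->
  \int[mu]_(x in A n) (u x * w n x) @[n --> \oo] --> \int[mu]_(x in D) u x.
Proof.
move=> mD mA AD ui mw w01 Ae wc.
pose v n := (fun x => u x * w n x) \_ (A n).
have mu_ : measurable_fun D u by case/integrableP : ui => /measurable_EFinP.
rewrite (_ : (fun n => _) = (fun n => \int[mu]_(x in D) v n x)); last first.
  by apply/funext => n; rewrite /v -Rintegral_mkcondr setIidr.
have mv n : measurable_fun D (v n).
  have : measurable_fun (D `&` A n) (fun x => u x * w n x).
    rewrite setIidr//; apply: measurable_funM => //; apply: measurable_funS mu_ => //.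
  by move/(measurable_restrict _ (mA n) mD).
apply: fine_cvg; rewrite fineK; last exact: integrable_fin_num.
apply: (@dominated_cvg _ _ _ mu D mD (fun n x => (v n x)%:E) _ (EFin \o (fun x => `|u x|))).
- by move=> n; exact/measurable_EFinP.
- move=> x Dx; apply: cvg_EFin; first exact: nearW.
  have : (u x * w n x) @[n --> \oo] --> u x.
    by rewrite -[X in _ --> X]mulr1; apply: cvgM; [exact: cvg_cst|exact: wc].
  apply: cvg_trans; apply: near_eq_cvg; near=> n.
  by rewrite /= /v patchE mem_set//; near: n; exact: Ae.
- by [].
- exact: (integrable_norm ui).
- move=> n x Dx; rewrite /= lee_fin /v patchE.
  case: ifPn => [|]; last by rewrite normr0.
  rewrite inE => /w01 /andP[w0 w1].
  by rewrite normrM (ger0_norm w0) ler_piMr.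
Unshelve. all: by end_near. Qed.

Lemma lip_derive (K dK : R -> R) (a b e : R) :
  (forall x, Num.min a b <= x <= Num.max a b -> is_derive x (1 : R) K (dK x)) ->
  (forall x, Num.min a b <= x <= Num.max a b -> `|dK x| <= e) ->
  `|K b - K a| <= e * `|b - a|.
Proof.
wlog ab : a b / a < b => [wl|].
  case: (boolP (a < b)) => [|]; first exact: wl.
  rewrite -leNgt le_eqVlt => /predU1P[->|ba].
    by move=> _ _; rewrite !subrr normr0 mulr0.
  by move=> h1 h2; rewrite distrC (distrC b); apply: wl; rewrite // minC maxC.
rewrite (min_l (ltW ab)) (max_r (ltW ab)) => h1 h2.
have cK : {within `[a, b], continuous K}.
  by apply: cts_within => x /h1 /is_derive_cts.
have h3 x : x \in `]a, b[ -> is_derive x (1 : R) K (dK x).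
  by rewrite in_itv/= => /andP[? ?]; apply: h1; rewrite !ltW.
have [x + ->] := MVT ab h3 cK.
rewrite in_itv/= => /andP[ax xb]; rewrite normrM ler_wpM2r//.
by apply: h2; rewrite !ltW.
Qed.

(** The mean value inequality for [Gn n - l * id] bounds its increments by [e * |h|] uniformly in
    [n], and this survives the limit. Only closeness of the derivatives to the one number [l] is
    asked, for late [n] and times near [t]. The filter is arbitrary because the lemma serves both s
    -> 0+ and n -> oo. *)
Lemma is_derive_limit (I : Type) (F : set_system I) (FF : ProperFilter F)
    (Gn gn : I -> R -> R) (G : R -> R) (t l : R) :
  (\forall n \near F & t' \near t, is_derive t' (1 : R) (Gn n) (gn n t')) ->
  (\forall t' \near t, Gn n t' @[n --> F] --> G t') ->
  (forall e, 0 < e -> \forall n \near F & t' \near t, `|gn n t' - l| <= e) ->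
  is_derive t (1 : R) G l.
Proof.
move=> hd hc hl.
suff key : h^-1 *: (G (h + t) - G t) @[h --> 0^'] --> l.
  apply: DeriveDef.
    apply/cvg_ex; exists l.
    by under eq_fun do rewrite scaler1.
  rewrite /derive; under eq_fun do rewrite scaler1.
  exact: cvg_lim key.
apply/cvgrPdist_le => e e0.
have := hl _ e0; have := hd.
move=> [[U1 V1]/= [FU1 [r1 /= r10 V1r]] UV1] [[U2 V2]/= [FU2 [r2 /= r20 V2r]] UV2].
case: hc => r3 /= r30 hc.
pose r := Num.min r1 (Num.min r2 r3).
have r0 : 0 < r by rewrite !lt_min r10 r20.
exists r => //= h /=; rewrite sub0r normrN !lt_min => /and3P[h1 h2 h3] hn0.
have bal x : Num.min t (h + t) <= x <= Num.max t (h + t) -> `|t - x| <= `|h|.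
  have [h0|h0] := leP 0 h.
    rewrite min_l ?max_r ?lerDr// => /andP[? ?].
    by rewrite distrC ger0_norm ?ger0_norm; lra.
  rewrite min_r ?max_l; [|lra|lra] => /andP[? ?].
  by rewrite ger0_norm ?ltr0_norm; lra.
have Gt : Gn n t @[n --> F] --> G t by apply: hc; rewrite /= subrr normr0.
have Gh : Gn n (h + t) @[n --> F] --> G (h + t).
  by apply: hc; rewrite /= opprD addrCA subrr addr0 normrN.
have lim : `|(G (h + t) - l * (h + t)) - (G t - l * t)| <= e * `|h|.
  have cv : `|(Gn n (h + t) - l * (h + t)) - (Gn n t - l * t)| @[n --> F] -->
      `|(G (h + t) - l * (h + t)) - (G t - l * t)|.
    apply: cvg_norm; apply: cvgB; apply: cvgB => //; exact: cvg_cst.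
  apply: (cvgr_to_le cv); near=> n.
  have Un1 : U1 n by near: n.
  have Un2 : U2 n by near: n.
  have := @lip_derive (fun x => Gn n x - l * x) (fun x => gn n x - l) t (h + t) e.
  rewrite addrK; apply => x /bal xh.
    apply: der_sub (der_mul (der_cst l x erefl) (der_id x erefl) erefl) _.
      by apply: (UV1 (n, x)); split => //=; apply: V1r; rewrite /= (le_lt_trans xh).
    by rewrite mul0r add0r mulr1.
  by apply: (UV2 (n, x)); split => //=; apply: V2r; rewrite /= (le_lt_trans xh).
have hp : 0 < `|h| by rewrite normr_gt0.
rewrite -(ler_pM2r hp) -normrM.
rewrite -normrN.
have -> : - ((l - h^-1 *: (G (h + t) - G t)) * h) =
    (G (h + t) - l * (h + t)) - (G t - l * t).
  by rewrite /GRing.scale/=; field.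
by [].
Unshelve. all: by end_near. Qed.

End integral_limits.

(** * Error caused by the cutoff *)

Section cutoff_estimate.
Variable R : realType.
Implicit Types x a b : R.

Lemma ler_norm_mul x y a b : `|x| <= a -> `|y| <= b -> `|x * y| <= a * b.
Proof. by move=> xa yb; rewrite normrM ler_pM. Qed.

(** With [x = p ^+ 3] and [N = m ^+ 3], the coefficients [A] and [B] grow only like 1 + p. The
    defect 1 - eta is at most 2 p / m, and [eta1], [eta2] are of orders 1/N and 1/N^2, so every
    error term is below (1 + x) / m up to a constant: it becomes small against the mass and the
    number density. *)
Lemma cutoff_pointwise (C lam m p f f1 f2 A B : R) :
  0 <= C -> 1 <= lam -> 1 <= m -> 0 <= p -> p <= m ->
  `|f| <= C * p ^+ 3 -> `|f1| <= C -> `|f2| <= C ->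
  `|A| <= 1 + p -> `|B| <= lam * (1 + p) ->
  `|((f2 * eta (m ^+ 3) (p ^+ 3) + 2 * f1 * eta1 (m ^+ 3) (p ^+ 3) +
      f * eta2 (m ^+ 3) (p ^+ 3)) * A -
     (f1 * eta (m ^+ 3) (p ^+ 3) + f * eta1 (m ^+ 3) (p ^+ 3)) * B) -
    (f2 * A - f1 * B)| <= 24 * (C * lam * (1 + p ^+ 3) / m).
Proof.
move=> C0 l1 m1 p0 pm hf hf1 hf2 hA hB.
have m0 : 0 < m by lra.
set N := m ^+ 3; set x := p ^+ 3; rewrite -/x in hf.
have N0 : 0 < N by rewrite exprn_gt0.
have x0 : 0 <= x by rewrite exprn_ge0.
pose r := p / m.
have r0 : 0 <= r by rewrite divr_ge0// ltW.
have r1 : r <= 1 by rewrite ler_pdivrMr// mul1r.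
have xN : x / N = r ^+ 3 by rewrite /x /N /r expr_div_n.
have r3 : r ^+ 3 <= r.
  by rewrite exprS ler_piMr// expr_le1.
have r30 : 0 <= r ^+ 3 by rewrite exprn_ge0.
set M := C * lam * (1 + x) / m.
have im : m * m^-1 = 1 by rewrite divff// gt_eqF.
set i := m^-1 in im *.
have i0 : 0 < i by rewrite invr_gt0.
have i1 : i <= 1 by rewrite invf_le1.
have pp : (1 + p) * p <= 2 * (1 + x).
  rewrite /x; have [p1|p1] := leP p 1.
    have := exprn_ge0 3 p0; have : p * p <= 1 * 1 by rewrite ler_pM. lra.
  have h1 : p * 1 <= p * p by rewrite ler_pM//; lra.
  have h2 : p * p * 1 <= p * p * p by rewrite ler_wpM2l ?mulr_ge0// ltW.
  have -> : p ^+ 3 = p * p * p by ring.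
  by lra.
have p1x : 1 + p <= 2 * (1 + x).
  rewrite /x; have [p1|p1] := leP p 1; first by have := exprn_ge0 3 p0; lra.
  by have : p ^+ 1 <= p ^+ 3 by [rewrite ler_weXn2l// ltW]; rewrite expr1; lra.
have he : `|1 - eta N x| <= 2 * r.
  have r31 := le_trans r3 r1.
  rewrite /eta xN ger0_norm; last by rewrite subr_ge0 expr_le1 ?subr_ge0// gerBl.
  have -> : 1 - (1 - r ^+ 3) ^+ 2 = r ^+ 3 * (2 - r ^+ 3) by ring.
  by rewrite mulrC ler_pM// ?gerBl// subr_ge0 (le_trans r31)// ler1n.
have N1 : 1 <= N by rewrite exprn_ege1.
have Nm : m <= N.
  by rewrite /N -[leLHS]expr1 ler_weXn2l.
have iN : N^-1 <= i by rewrite /i lef_pV2.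
have iN0 : 0 < N^-1 by rewrite invr_gt0.
have h1 : `|eta1 N x| <= 2 * N^-1.
  rewrite /eta1 xN normrM -[leRHS]mulr1; apply: ler_pM => //.
    by rewrite normrN ger0_norm// divr_ge0// ltW.
  have [u0 u1] : 0 <= 1 - r ^+ 3 /\ 1 - r ^+ 3 <= 1 by rewrite subr_ge0 gerBl r30 (le_trans r3).
  by rewrite ger0_norm.
have h2 : `|eta2 N x| <= 2 * (N^-1 * N^-1).
  rewrite /eta2 -exprVn ger0_norm; last by rewrite mulr_ge0// exprn_ge0// ltW.
  by rewrite expr2.
have Cx0 : 0 <= C * x by rewrite mulr_ge0.
have lam0 : 0 <= lam by exact: le_trans l1.
have Cl : 0 <= C * lam by rewrite mulr_ge0.
have x1 : 0 <= 1 + x by rewrite addr_ge0.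
have mul0 : 0 <= m * (N^-1 * N^-1) by rewrite !mulr_ge0// ltW.
have e1 : (1 + p) * r <= 2 * (1 + x) * i.
  by rewrite /r mulrA; apply: ler_wpM2r => //; exact: ltW.
have p10 : 0 <= 1 + p by rewrite addr_ge0.
have e2 : (1 + p) * N^-1 <= 2 * (1 + x) * i.
  by apply: ler_pM => //; exact: ltW.
have mN : m * N^-1 <= i.
  have -> : m * N^-1 = i ^+ 2 by rewrite /N /i; field; rewrite gt_eqF.
  by rewrite expr2 ger_pMr.
have e3 : x * ((1 + p) * N^-1) <= 2 * (1 + x) * i.
  have : (1 + p) * N^-1 <= 2 * (m * N^-1).
    rewrite mulrA; apply: ler_wpM2r; first exact: ltW.
    by rewrite mulr_natl mulr2n lerD.
  move=> h; apply: (@le_trans _ _ (x * (2 * i))).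
    by apply: ler_wpM2l => //; apply: le_trans h _; rewrite ler_wpM2l.
  rewrite mulrCA -mulrA ler_wpM2l// ler_wpM2r ?(ltW i0)//.
  by rewrite lerDr.
have e4 : x * ((1 + p) * (N^-1 * N^-1)) <= 2 * (1 + x) * i.
  apply: le_trans e3; apply: ler_wpM2l => //; apply: ler_wpM2l => //.
  by rewrite ger_pMr// invf_le1.
clear r0 r1 xN r3 r30 im i1 pp p1x N1 Nm iN iN0 mul0 mN.
(* The five terms below are bounded by 2, 4, 2 times [Q] and 2, 2 times [Q * lam]. Since
   [Q <= 2 * M] and [Q * lam = 2 * M], they add up to the 24 of the statement. *)
pose Q := C * (2 * (1 + x) * i).
have QM : Q <= 2 * M.
  rewrite /Q /M -/i.
  have : C * (1 + x) * i * 1 <= C * (1 + x) * i * lam.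
    by apply: ler_wpM2l => //; rewrite !mulr_ge0// ltW.
  by lra.
have QlM : Q * lam = 2 * M by rewrite /Q /M -/i; ring.
have t1 : `|f2 * A * (1 - eta N x)| <= 2 * Q.
  apply: le_trans (ler_norm_mul (ler_norm_mul hf2 hA) he) _.
  by have := ler_wpM2l C0 e1; rewrite /Q; lra.
have t2 : `|2 * f1 * eta1 N x * A| <= 4 * Q.
  have -> : 2 * f1 * eta1 N x * A = 2 * (f1 * (eta1 N x * A)) by ring.
  rewrite normrM ger0_norm//.
  have := ler_norm_mul hf1 (ler_norm_mul h1 hA).
  by have := ler_wpM2l C0 e2; rewrite /Q; lra.
have t3 : `|f * eta2 N x * A| <= 2 * Q.
  have := ler_norm_mul hf (ler_norm_mul h2 hA); rewrite mulrA.
  by have := ler_wpM2l C0 e4; rewrite /Q; lra.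
have t4 : `|f1 * B * (1 - eta N x)| <= 2 * (Q * lam).
  apply: le_trans (ler_norm_mul (ler_norm_mul hf1 hB) he) _.
  by have := ler_wpM2l Cl e1; rewrite /Q; lra.
have t5 : `|f * eta1 N x * B| <= 2 * (Q * lam).
  have := ler_norm_mul hf (ler_norm_mul h1 hB); rewrite mulrA.
  by have := ler_wpM2l Cl e3; rewrite /Q; lra.
set a1 := f2 * A * (1 - eta N x) in t1; set a2 := 2 * f1 * eta1 N x * A in t2.
set a3 := f * eta2 N x * A in t3; set a4 := f1 * B * (1 - eta N x) in t4.
set a5 := f * eta1 N x * B in t5.
have -> : (f2 * eta N x + 2 * f1 * eta1 N x + f * eta2 N x) * A -
  (f1 * eta N x + f * eta1 N x) * B - (f2 * A - f1 * B) =
  (- a1 + a2 + a3) + (a4 - a5).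
  by rewrite /a1 /a2 /a3 /a4 /a5; ring.
clear hA hB hf hf1 hf2 he h1 h2 e1 e2 e3 e4.
have n1 := ler_normD (- a1 + a2 + a3) (a4 - a5).
have n2 := ler_normD (- a1 + a2) a3.
have n3 := ler_normD (- a1) a2.
have n4 := ler_normB a4 a5.
rewrite normrN in n3.
by rewrite QlM in t4 t5; lra.
Qed.

(** Beyond the cutoff the whole flux is error; there [m <= p] gives 1 + p <= 2 (1 + p^3) / m, so it
    obeys the same bound as inside. *)
Lemma cutoff_tail (C lam m p f1 f2 A B : R) :
  0 <= C -> 1 <= lam -> 1 <= m -> m <= p ->
  `|f1| <= C -> `|f2| <= C -> `|A| <= 1 + p -> `|B| <= lam * (1 + p) ->
  `|f2 * A - f1 * B| <= 24 * (C * lam * (1 + p ^+ 3) / m).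
Proof.
move=> C0 l1 m1 mp hf1 hf2 hA hB.
have m0 : 0 < m by lra.
have h : 1 + p <= 2 * ((1 + p ^+ 3) / m).
  rewrite mulrA ler_pdivlMr//.
  have h1 : p * m <= p * p by rewrite ler_pM//; lra.
  have h2 : p * p * 1 <= p * p * p by rewrite ler_pM ?mulr_ge0//; lra.
  have -> : p ^+ 3 = p * p * p by ring.
  by nra.
apply: le_trans (ler_normB _ _) _.
have k1 := ler_norm_mul hf2 hA; have k2 := ler_norm_mul hf1 hB.
have Cl : 0 <= C * lam by rewrite mulr_ge0//; lra.
have k3 := ler_wpM2l C0 h; have k4 := ler_wpM2l Cl h.
set z := (1 + p ^+ 3) / m in h k3 k4 *.
have z0 : 0 <= z by lra.
have k6 : 0 <= C * lam * z by rewrite mulr_ge0.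
have k5 : C * z * 1 <= C * z * lam by apply: ler_wpM2l => //; rewrite mulr_ge0.
have -> : C * lam * (1 + p ^+ 3) / m = C * lam * z by rewrite /z; ring.
by lra.
Qed.

End cutoff_estimate.

Section coefficients.
Variable R : realType.
Implicit Types (f : R -> R) (x t e l : R).

(* They agree with [dif] and [dri] for 0 <= x, and are continuous everywhere. *)
Definition difc e x := e * cbrt (1 + x / e).
Definition dric l x := 1 - cbrt x / cbrt l.

Lemma difcE e x : 0 < e -> 0 <= x -> dif e x = difc e x.
Proof.
move=> e0 x0; have xe : 0 <= x / e by rewrite divr_ge0// ltW.
by rewrite /dif /difc powR13// addr_ge0.
Qed.

Lemma dricE l x : 0 < l -> 0 <= x -> dri l x = dric l x.
Proof. exact: driE. Qed.

Lemma cts_fst f x t : {for x, continuous f} ->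
  {for (x, t), continuous (fun z : R * R => f z.1)}.
Proof.
move=> cf; exact: (@continuous_comp _ _ _ fst f (x, t) (@cvg_fst _ _ _ _ _) cf).
Qed.

Lemma cts_snd f x t : {for t, continuous f} ->
  {for (x, t), continuous (fun z : R * R => f z.2)}.
Proof.
move=> cf; exact: (@continuous_comp _ _ _ snd f (x, t) (@cvg_snd _ _ _ _ _) cf).
Qed.

Lemma cts_difc e : continuous (difc e).
Proof.
move=> x; apply: cvgM; first exact: cvg_cst.
have h : {for x, continuous (fun y : R => 1 + y / e)}.
  by apply: cvgD; [exact: cvg_cst|apply: cvgM; [exact: cvg_id|exact: cvg_cst]].
exact: (continuous_comp h (@continuous_cbrt _ _)).
Qed.

Lemma cts_dric l : continuous (dric l).
Proof.
move=> x; apply: cvgB; first exact: cvg_cst.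
by apply: cvgM; [exact: continuous_cbrt|exact: cvg_cst].
Qed.

Lemma Rintegral_cst_itv (a b k : R) : a < b ->
  \int[@lebesgue_measure R]_(x in `[a, b]) k = k * (b - a).
Proof.
move=> ab; have d (x : R) : a <= x <= b -> is_derive x (1 : R) (fun x => k * x) k.
  move=> _; apply: der_mul (der_cst k x erefl) (der_id x erefl) _.
  by rewrite mul0r mulr1 add0r.
have := FTC2_is_derive (f := fun=> k) ab d => ->; first by rewrite mulrBr.
by move=> x _; exact: cst_continuous.
Qed.

End coefficients.

(** * Weak form with a cutoff at infinity, up to the boundary [x = 0] *)

Section weak_cutoff.
Variables (R : realType) (eps : R) (c0 L : R -> R) (c : R -> R -> R).
Hypothesis eps_gt0 : 0 < eps.
Hypothesis H : diffusive_LSW_solution eps c0 L c.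
Notation mu := (@lebesgue_measure R).
Notation cx := (cx c).
Implicit Types (g f : R -> R) (x t s N : R).

Lemma L_pos t : 0 < t -> 0 < L t.
Proof. by move=> t0; apply: (LSW_L_gt0 H); exact: ltW. Qed.

Lemma cts_L t : 0 < t -> {for t, continuous L}.
Proof.
move=> t0; have /subspace_continuousP := LSW_L_continuous H.
move=> /(_ t); rewrite /= in_itv/= andbT => /(_ (ltW t0)) h P /h hP.
have {}hP : \forall y \near t, `[0, +oo[%classic y -> P (L y) := hP.
suff : \forall y \near t, P (L y) by [].
near=> y.
have y0 : 0 < y by near: y; exact: lt_nbhsr.
have : `[0, +oo[%classic y -> P (L y) by near: y; exact: hP.
by apply; rewrite /= in_itv/= andbT ltW.
Unshelve. all: by end_near. Qed.

Lemma cts_drift x t : 0 < t ->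
  {for (x, t), continuous (fun z : R * R => dric (L z.2) z.1)}.
Proof.
move=> t0; apply: cvgB; first exact: cvg_cst.
apply: cvgM; first exact: cts_fst (@continuous_cbrt _ _).
apply: cvgV; first by rewrite lt0r_neq0// cbrt_gt0// L_pos.
apply: (@cts_snd _ (fun t => cbrt (L t))).
exact: (continuous_comp (cts_L t0) (@continuous_cbrt _ _)).
Qed.

(** The integrand left for the time derivative of the integral of f c once all derivatives have been
    moved to the weight. It is linear in the pair [f1], [f2]. *)
Definition flux (f1 f2 : R -> R) (z : R * R) : R :=
  (f2 z.1 * difc eps z.1 - f1 z.1 * dric (L z.2) z.1) * cx z.

Lemma fluxE f1 f2 x t :
  flux f1 f2 (x, t) = (f2 x * difc eps x - f1 x * dric (L t) x) * cx (x, t).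
Proof. by []. Qed.

Lemma cts_flux f1 f2 x t : 0 < t -> {for x, continuous f1} ->
  {for x, continuous f2} -> {for (x, t), continuous (flux f1 f2)}.
Proof.
move=> t0 c1 c2; apply: cvgM; last exact: (cts_cx H).
apply: cvgB; apply: cvgM.
- exact: cts_fst.
- exact: cts_fst (@cts_difc _ _ _).
- exact: cts_fst.
- exact: cts_drift.
Qed.

Lemma cts_flux_x f1 f2 x t : 0 < t -> {for x, continuous f1} ->
  {for x, continuous f2} -> {for x, continuous (fun y : R => flux f1 f2 (y, t))}.
Proof.
move=> t0 c1 c2.
exact: (@continuous_comp _ _ _ _ (flux f1 f2) _ (@cts_pairl _ x t) (cts_flux t0 c1 c2)).
Qed.

Lemma flux0 f1 f2 t : 0 < t -> flux f1 f2 (0, t) = 0.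
Proof. by move=> t0; rewrite /flux cxE// (LSW_dirichlet H t0) mulr0. Qed.

(** The limit s -> 0+ of [weak_deriv]. The boundary term [b] tends to 0 because [cx] is jointly
    continuous at (0, t) and vanishes there. *)
Lemma weak_cutoff f f1 f2 N t : 0 < N -> 0 < t ->
  (forall x, 0 <= x -> C2_at f f1 f2 x) -> f 0 = 0 ->
  is_derive t (1 : R)
    (fun t => \int[mu]_(x in `[0, N]) (f x * eta N x * cx (x, t)))
    (\int[mu]_(x in `[0, N])
       flux (fun y => f1 y * eta N y + f y * eta1 N y)
         (fun y => f2 y * eta N y + 2 * f1 y * eta1 N y + f y * eta2 N y) (x, t)).
Proof.
move=> N0 t0 fC f0.
set g1 := (X in flux X _); set g2 := (X in flux _ X).
have gC x : 0 <= x -> C2_at (fun y => f y * eta N y) g1 g2 x.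
  by move=> x0; apply: C2_mul; [exact: fC|exact: C2_eta].
(* Subtracting [f s] makes the test function vanish at [s]. By linearity of the flux the price is
   [f s] times the flux [q] of [eta], which tends to 0 since [f 0 = 0]. *)
pose F s t := \int[mu]_(x in `[s, N]) ((f x - f s) * eta N x * c x t).
pose b (z : R * R) := f1 z.1 * eta N z.1 * (difc eps z.1 * cx z).
pose h := flux g1 g2.
pose q := flux (eta1 N) (eta2 N).
pose dF s t := b (s, t) + \int[mu]_(x in `[s, N]) (h (x, t) - f s * q (x, t)).
have near0 (P : R -> Prop) : (\forall s \near (0 : R), P s) -> \forall s \near 0^'+, P s.
  exact: cvg_within.
have cx_ x u : 0 < u -> 0 <= x -> c x u = cx (x, u) by move=> _ x0; rewrite cxE.
have ce x : [/\ {for x, continuous (eta N)}, {for x, continuous (eta1 N)} &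
    {for x, continuous (eta2 N)}] by exact: C2_cts (C2_eta N x).
have dFE (s u : R) : 0 < s -> s < N -> 0 < u -> is_derive u (1 : R) (F s) (dF s u).
  move=> s0 sN u0.
  have Lu := L_pos u0.
  have hC x : s <= x <= N -> C2_at (fun y => (f y - f s) * eta N y)
      (fun y => f1 y * eta N y + (f y - f s) * eta1 N y)
      (fun y => f2 y * eta N y + 2 * f1 y * eta1 N y + (f y - f s) * eta2 N y) x.
    move=> /andP[sx xN]; apply: C2_mul; last exact: C2_eta.
    by apply: C2_subr; apply: fC; lra.
  have eN : eta N N = 0 by rewrite /eta divff ?subrr ?expr0n// gt_eqF.
  have eN1 : eta1 N N = 0 by rewrite /eta1 divff ?subrr ?mulr0// gt_eqF.
  have h1 : (f s - f s) * eta N s = 0 by rewrite subrr mul0r.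
  have h2 : (f N - f s) * eta N N = 0 by rewrite eN mulr0.
  have h3 : f1 N * eta N N + (f N - f s) * eta1 N N = 0.
    by rewrite eN eN1 !mulr0 addr0.
  apply: (is_derive_eq (weak_deriv eps_gt0 H s0 sN u0 hC h1 h2 h3)).
  rewrite /dF /b /= subrr mul0r addr0 difcE ?(ltW s0)// cxE ?(ltW s0)//.
  congr (_ + _).
  apply: eq_Rintegral => x; rewrite inE/= in_itv/= => /andP[sx xN].
  have x0 : 0 <= x by lra.
  by rewrite /h /q /flux/= cxE// difcE// dricE// /g1 /g2; ring.
have cf x : 0 <= x -> {for x, continuous f} by move=> /fC /C2_cts[].
have ch x : 0 <= x -> {for (x, t), continuous h}.
  by move=> /gC /C2_cts[_ ? ?]; exact: cts_flux.
have cq x : {for (x, t), continuous q}.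
  by have [_ ? ?] := ce x; exact: cts_flux.
have mI a : measurable (`[a, N]%classic : set (measurableTypeR R)).
  exact: measurable_itv.
apply: (@is_derive_limit _ _ (0^'+) _ F dF).
- near=> s u => /=; apply: dFE.
  + by near: s; exact: nbhs_right_gt.
  + by near: s; exact: nbhs_right_lt.
  + by near: u; exact: lt_nbhsr.
- near=> u.
  have u0 : 0 < u by near: u; exact: lt_nbhsr.
  pose w (x : R) := f x * eta N x * cx (x, u).
  pose v (x : R) := eta N x * cx (x, u).
  have cw x : 0 <= x -> {for x, continuous w}.
    move=> x0; apply: cvgM; last exact: (cts_cx_x H).
    by apply: cvgM; [exact: cf|have [] := ce x].
  have cv x : {for x, continuous v}.
    by apply: cvgM; [have [] := ce x|exact: (cts_cx_x H)].
  have [Q Q0 hQ] : exists2 Q, 0 < Q & forall x, 0 <= x <= N -> `|v x| <= Q.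
    by apply: cts_bounded => x _.
  apply/cvgrPdist_le => e e0.
  pose e1 := e / N.
  have e10 : 0 < e1 by rewrite divr_gt0.
  have w0 : w 0 = 0 by rewrite /w f0 !mul0r.
  have [r /= r0 hr] : \forall x \near 0^'+, `|w x| <= e1.
    apply: near0; have /cvgrPdist_le/(_ _ e10) := cw 0 (lexx _).
    by rewrite w0; apply: filterS => x; rewrite sub0r normrN.
  near=> s.
  have s0 : 0 < s by near: s; exact: nbhs_right_gt.
  have sN : s < N by near: s; exact: nbhs_right_lt.
  have fs : `|f s| * Q <= e1.
    rewrite -ler_pdivlMr//; near: s; apply: near0.
    have e2 : 0 < e1 / Q by rewrite divr_gt0.
    have /cvgrPdist_le/(_ _ e2) := cf 0 (lexx _).
    by rewrite f0; apply: filterS => x; rewrite sub0r normrN.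
  have sr : s < r by near: s; exact: nbhs_right_lt.
  rewrite distrC /F.
  have -> : \int[mu]_(x in `[s, N]) ((f x - f s) * eta N x * c x u) =
      \int[mu]_(x in `[s, N]) (w x - f s * v x).
    apply: eq_Rintegral => x; rewrite inE/= in_itv/= => /andP[sx xN].
    by rewrite cx_ ?(le_trans (ltW s0))// /w /v; ring.
  apply: le_trans (@Rintegral_approx _ `[s, N]%classic `[0, N]%classic _ w (fun=> e1) _ _ _ _ _ _ _ _) _ => //.
  + by move=> x /=; rewrite !in_itv/= => /andP[sx ->]; rewrite andbT (le_trans (ltW s0)).
  + apply: cts_integrable => x /andP[sx xN]; apply: cvgB.
      by apply: cw; exact: le_trans (ltW s0) sx.
    by apply: cvgM; [exact: cvg_cst|exact: cv].
  + by apply: cts_integrable => x /andP[x0 xN]; exact: cw.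
  + by apply: cts_integrable => x _; exact: cst_continuous.
  + move=> x /=; rewrite in_itv/= => /andP[sx xN].
    rewrite addrC addKr normrN normrM; apply: le_trans fs.
    by apply: ler_wpM2l => //; apply: hQ; rewrite (le_trans (ltW s0)).
  + move=> x /=; rewrite !in_itv/= => /andP[x0 xN] /negP.
    rewrite xN andbT -ltNge => xs.
    have [->|xn0] := eqVneq x 0; first by rewrite w0 normr0 ltW.
    apply: hr; last by rewrite lt_neqAle eq_sym xn0.
    by rewrite /= sub0r normrN ger0_norm// (lt_trans xs).
  + rewrite Rintegral_cst_itv// subr0.
    by rewrite /e1 divfK// gt_eqF.
- move=> e e0.
  (* The boundary term will cost [e1] and the integral over [0, N] at most [2 * e1 * N]. *)
  pose e1 := e / (2 * N + 1).
  have e10 : 0 < e1 by rewrite divr_gt0// ltr_wpDl// mulr_ge0// ltW.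
  have [Q Q0 /= hQ] : exists2 Q, 0 < Q &
      \forall u \near t, forall x, 0 <= x <= N -> `|q (x, u)| <= Q.
    by apply: tube_bounded => x _.
  have hT : \forall u \near t, forall x, 0 <= x <= N -> `|h (x, u) - h (x, t)| <= e1.
    by apply: tube => // x /andP[x0 _]; exact: ch.
  have h0 : h (0, t) = 0 by exact: flux0.
  have [r /= r0 hr] : \forall x \near 0^'+, `|h (x, t)| <= e1.
    apply: near0.
    have /cvgrPdist_le/(_ _ e10) : {for 0, continuous (fun y => h (y, t))}.
      by have [_ ? ?] := C2_cts (gC 0 (lexx _)); exact: cts_flux_x.
    by rewrite h0; apply: filterS => x; rewrite sub0r normrN.
  have [[U V] /= [U0 Vt] UV] : \forall z \near (0, t), `|b z| <= e1.
    have cb : {for (0, t), continuous b}.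
      have [_ cf1 _] := C2_cts (fC 0 (lexx _)).
      apply: cvgM.
        by apply: cvgM; apply: cts_fst => //; have [] := ce 0.
      by apply: cvgM; [exact: cts_fst (@cts_difc _ _ _)|exact: (cts_cx H)].
    have b0 : b (0, t) = 0 by rewrite /b cxE// (LSW_dirichlet H t0) !mulr0.
    move/cvgrPdist_le : cb => /(_ _ e10).
    by rewrite b0; apply: filterS => x; rewrite sub0r normrN.
  near=> s u => /=.
  have s0 : 0 < s by near: s; exact: nbhs_right_gt.
  have sN : s < N by near: s; exact: nbhs_right_lt.
  have u0 : 0 < u by near: u; exact: lt_nbhsr.
  have fs : `|f s| * Q <= e1.
    rewrite -ler_pdivlMr//; near: s; apply: near0.
    have e2 : 0 < e1 / Q by rewrite divr_gt0.
    have /cvgrPdist_le/(_ _ e2) := cf 0 (lexx _).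
    by rewrite f0; apply: filterS => x; rewrite sub0r normrN.
  have sr : s < r by near: s; exact: nbhs_right_lt.
  have bs : `|b (s, u)| <= e1.
    apply: UV; split => /=; first by near: s; exact: near0.
    by near: u; exact: Vt.
  have hQu : forall x, 0 <= x <= N -> `|q (x, u)| <= Q by near: u; exact: hQ.
  have hTu : forall x, 0 <= x <= N -> `|h (x, u) - h (x, t)| <= e1.
    by near: u; exact: hT.
  have chx x v : 0 <= x -> 0 < v -> {for x, continuous (fun y : R => h (y, v))}.
    by move=> /gC /C2_cts[_ ? ?] v0; exact: cts_flux_x.
  have main : `|\int[mu]_(x in `[s, N]) (h (x, u) - f s * q (x, u)) -
      \int[mu]_(x in `[0, N]) h (x, t)| <= 2 * e1 * N.
    apply: le_trans (@Rintegral_approx _ `[s, N]%classic `[0, N]%classic _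
      (fun x => h (x, t)) (fun=> 2 * e1) _ _ _ _ _ _ _ _) _ => //.
    + by move=> x /=; rewrite !in_itv/= => /andP[sx ->]; rewrite andbT (le_trans (ltW s0)).
    + apply: cts_integrable => x /andP[sx xN]; apply: cvgB.
        by apply: chx => //; exact: le_trans (ltW s0) sx.
      apply: cvgM; first exact: cvg_cst.
      by have [_ ? ?] := ce x; exact: cts_flux_x.
    + by apply: cts_integrable => x /andP[x0 xN]; exact: chx.
    + by apply: cts_integrable => x _; exact: cst_continuous.
    + move=> x /=; rewrite in_itv/= => /andP[sx xN].
      have x0N : 0 <= x <= N by rewrite (le_trans (ltW s0)).
      rewrite addrAC; apply: le_trans (ler_normB _ _) _.
      rewrite mulr_natl mulr2n; apply: lerD; first exact: hTu.
      rewrite normrM; apply: le_trans fs.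
      by apply: ler_wpM2l => //; exact: hQu.
    + move=> x /=; rewrite !in_itv/= => /andP[x0 xN] /negP.
      rewrite xN andbT -ltNge => xs.
      have [->|xn0] := eqVneq x 0; first by rewrite h0 normr0 mulr_ge0// ltW.
      apply: (@le_trans _ _ e1); last by rewrite ler_peMl ?ler1n// ltW.
      apply: hr; last by rewrite lt_neqAle eq_sym xn0.
      by rewrite /= sub0r normrN ger0_norm// (lt_trans xs).
    + by rewrite Rintegral_cst_itv// subr0.
  rewrite /dF -addrA; apply: le_trans (ler_normD _ _) _.
  apply: le_trans (lerD bs main) _.
  rewrite (_ : e1 + 2 * e1 * N = e1 * (2 * N + 1)); last by ring.
  by rewrite /e1 divfK// gt_eqF// ltr_wpDl// mulr_ge0// ltW.
Unshelve. all: by end_near. Qed.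

End weak_cutoff.

Section halfline.
Variable R : realType.

Definition halfline : set (measurableTypeR R) := `[0, +oo[%classic.

Lemma measurable_halfline : measurable halfline.
Proof. exact: measurable_itv. Qed.

Lemma halflineE (x : R) : halfline x = (0 <= x) :> Prop.
Proof. by rewrite /halfline/= in_itv/= andbT. Qed.

Lemma in_halfline (x : R) : (x \in halfline) = (0 <= x).
Proof. by apply/idP/idP; rewrite inE halflineE. Qed.

Lemma sub_halfline (a b : R) : 0 <= a -> `[a, b]%classic `<=` halfline.
Proof.
by move=> a0 x; rewrite halflineE/= in_itv/= => /andP[ax _]; exact: le_trans ax.
Qed.

End halfline.

(** * Weak form on the half-line for weights of linear growth *)

Section weak_linear.
Variables (R : realType) (eps : R) (c0 L : R -> R) (c : R -> R -> R).
Hypothesis eps_gt0 : 0 < eps.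
Hypothesis eps_le1 : eps <= 1.
Hypothesis H : diffusive_LSW_solution eps c0 L c.
Notation mu := (@lebesgue_measure R).
Notation cx := (cx c).
Notation flux := (flux eps L c).
Implicit Types (g f : R -> R) (x t s : R).

Notation D := (@halfline R).
Let mD := @measurable_halfline R.

Lemma cts_meas f : (forall x, 0 <= x -> {for x, continuous f}) -> measurable_fun D f.
Proof.
move=> cf; apply: subspace_continuous_measurable_fun => //.
by apply: continuous_in_subspaceT => x; rewrite in_halfline => /cf.
Qed.

Lemma meas_mul_cx f t : 0 < t -> (forall x, 0 <= x -> {for x, continuous f}) ->
  measurable_fun D (fun x => f x * cx (x, t)).
Proof.
move=> t0 cf; apply: cts_meas => x x0; apply: cvgM; first exact: cf.
exact: (cts_cx_x H).
Qed.

Lemma mass_cx t : 0 < t -> (\int[mu]_(x in D) (x * cx (x, t))%:E = 1)%E.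
Proof.
move=> t0; rewrite -(LSW_conservation H (ltW t0)); apply: eq_integral => x.
by rewrite in_halfline => x0; rewrite cxE.
Qed.

Lemma integrable_mass t : 0 < t -> mu.-integrable D (EFin \o (fun x => x * cx (x, t))).
Proof.
move=> t0; apply/integrableP; split.
  by apply/measurable_EFinP; apply: meas_mul_cx => // x _; exact: cvg_id.
rewrite (_ : (\int[mu]_(x in D) _)%E = \int[mu]_(x in D) (x * cx (x, t))%:E)%E.
  by rewrite mass_cx// ltry.
apply: eq_integral => x; rewrite in_halfline => x0.
by rewrite /= ger0_norm// mulr_ge0// (cx_ge0 H).
Qed.

Lemma Rmass t : 0 < t -> \int[mu]_(x in D) (x * cx (x, t)) = 1.
Proof. by move=> t0; rewrite /Rintegral mass_cx. Qed.

(** Conservation of mass makes x c integrable but does not bound the number density near 0. There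
    the continuity of [cx] on [0, 1] is used instead, and beyond 1 the density is below x c. *)
Let U t (x : R) : R := (fun y : R => cx (y, t)) \_ (`[0, 1]%classic) x.

Lemma U_integrable t : 0 < t -> mu.-integrable D (EFin \o U t).
Proof.
move=> t0; rewrite /U -restrict_EFin; apply/integrable_restrict => //.
rewrite setIidr; last exact: sub_halfline.
by apply: cts_integrable => x _; exact: (cts_cx_x H).
Qed.

Lemma cx_leU t x : 0 < t -> 0 <= x -> (1 + x) * cx (x, t) <= 2 * U t x + 2 * (x * cx (x, t)).
Proof.
move=> t0 x0; have c0' := cx_ge0 H x t0; rewrite /U patchE.
have xc : 0 <= x * cx (x, t) by rewrite mulr_ge0.
case: ifPn => [_|]; first by lra.
rewrite notin_setE/= in_itv/= x0/= => /negP; rewrite -ltNge => x1.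
have : 1 * cx (x, t) <= x * cx (x, t) by rewrite ler_wpM2r// ltW.
by rewrite /point/=; lra.
Qed.

Lemma dominating t : 0 < t ->
  mu.-integrable D (EFin \o (fun x => 2 * U t x + 2 * (x * cx (x, t)))).
Proof.
move=> t0; apply: (integrableD mD (f := EFin \o (fun x => 2 * U t x))
  (g := EFin \o (fun x => 2 * (x * cx (x, t))))).
- exact: (integrableZl mD 2 (U_integrable t0)).
- exact: (integrableZl mD 2 (integrable_mass t0)).
Qed.

Lemma integrable_lin f t C : 0 < t -> (forall x, 0 <= x -> {for x, continuous f}) ->
  0 <= C -> (forall x, 0 <= x -> `|f x| <= C * (1 + x)) ->
  mu.-integrable D (EFin \o (fun x => f x * cx (x, t))).
Proof.
move=> t0 cf C0 hf.
apply: (@integrable_dominated _ _ _ (fun x => C * (2 * U t x + 2 * (x * cx (x, t))))) => //.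
- exact: meas_mul_cx.
- exact: (integrableZl mD C (dominating t0)).
- move=> x; rewrite halflineE => x0.
  rewrite normrM (ger0_norm (cx_ge0 H x t0)).
  apply: le_trans (ler_wpM2l C0 (cx_leU t0 x0)).
  by rewrite mulrA; apply: ler_wpM2r; [exact: (cx_ge0 H)|exact: hf].
Qed.

Lemma integrable_1x t : 0 < t -> mu.-integrable D (EFin \o (fun x => (1 + x) * cx (x, t))).
Proof.
move=> t0; apply: (@integrable_lin (fun x => 1 + x) t 1) => // x x0.
- by apply: cvgD; [exact: cvg_cst|exact: cvg_id].
- by rewrite ger0_norm ?mul1r// addr_ge0.
Qed.

(** The bound holds uniformly for times near [t], by the tube bound on [0, 1] and the exact value 1
    of the mass. It makes the cutoff error uniform in time. *)
Lemma mass_bounded t : 0 < t -> exists2 B, 0 < B &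
  \forall u \near t, \int[mu]_(x in D) ((1 + x) * cx (x, u)) <= B.
Proof.
move=> t0.
have [B B0 /= hB] : exists2 B, 0 < B &
    \forall u \near t, forall x, 0 <= x <= 1 -> `|cx (x, u)| <= B.
  by apply: tube_bounded => x _; exact: (cts_cx H).
exists (2 * B + 2); first by rewrite addr_gt0// mulr_gt0.
near=> u.
have u0 : 0 < u by near: u; exact: lt_nbhsr.
have hu : forall x, 0 <= x <= 1 -> `|cx (x, u)| <= B by near: u; exact: hB.
apply: le_trans (le_Rintegral mD (integrable_1x u0) (dominating u0) _) _.
  by move=> x; rewrite halflineE; exact: cx_leU.
have -> : \int[mu]_(x in D) (2 * U u x + 2 * (x * cx (x, u))) =
    2 * \int[mu]_(x in D) U u x + 2 * \int[mu]_(x in D) (x * cx (x, u)).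
  rewrite -(RintegralZl 2 mD (U_integrable u0)) -(RintegralZl 2 mD (integrable_mass u0)).
  apply: (@RintegralD _ _ _ mu D (fun x => 2 * U u x) (fun x => 2 * (x * cx (x, u)))) => //.
  - exact: (integrableZl mD 2 (U_integrable u0)).
  - exact: (integrableZl mD 2 (integrable_mass u0)).
rewrite Rmass// mulr1 lerD2r ler_wpM2l//.
rewrite /U -Rintegral_mkcondr setIidr; last exact: sub_halfline.
have <- : \int[mu]_(x in `[0, 1]) B = B by rewrite Rintegral_cst_itv// subr0 mulr1.
apply: le_Rintegral => //.
- by apply: cts_integrable => x _; exact: (cts_cx_x H).
- by apply: cts_integrable => x _; exact: cst_continuous.
- move=> x /=; rewrite in_itv/= => /hu; apply: le_trans; exact: ler_norm.
Unshelve. all: by end_near. Qed.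

(** A cube, so that the cutoff estimates can use its root; the successor keeps this root at least
    1. *)
Definition cutoffs (n : nat) : R := n.+1%:R ^+ 3.

Lemma cutoffs_gt0 n : 0 < cutoffs n.
Proof. by rewrite exprn_gt0// ltr0n. Qed.

Lemma cutoffs_ge n : n.+1%:R <= cutoffs n.
Proof. by rewrite /cutoffs -[leLHS]expr1 ler_weXn2l// ler1n. Qed.

Lemma eta01 N x : 0 < N -> 0 <= x <= N -> 0 <= eta N x <= 1.
Proof.
move=> N0 /andP[x0 xN]; rewrite /eta sqr_ge0/= expr_le1//.
- by rewrite gerBl divr_ge0// ltW.
- by rewrite subr_ge0 ler_pdivrMr// mul1r.
Qed.

Lemma cutoff_cvg u : mu.-integrable D (EFin \o u) ->
  \int[mu]_(x in `[0, cutoffs n]) (u x * eta (cutoffs n) x) @[n --> \oo]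
  --> \int[mu]_(x in D) u x.
Proof.
move=> ui.
apply: (@trunc_cvg _ D u (fun n => eta (cutoffs n)) (fun n => `[0, cutoffs n]%classic)) => //.
- by move=> n; exact: sub_halfline.
- move=> n; have : measurable_fun D (eta (cutoffs n)).
    by apply: cts_meas => x _; have [] := C2_cts (C2_eta (cutoffs n) x).
  by apply: measurable_funS => //; exact: sub_halfline.
- by move=> n x /=; rewrite in_itv/=; exact: eta01 (cutoffs_gt0 n).
- move=> x; rewrite halflineE => x0; near=> n.
  rewrite /= in_itv/= x0/=; apply: le_trans (cutoffs_ge n).
  apply: (@le_trans _ _ n%:R); last by rewrite ler_nat.
  by near: n; exact: nbhs_infty_ger.
- move=> x; rewrite halflineE => x0.
  apply/cvgrPdist_le => e e0; near=> n.
  have n1 : 0 < n.+1%:R :> R by rewrite ltr0n.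
  have r0 : 0 <= x / cutoffs n by rewrite divr_ge0// ltW// cutoffs_gt0.
  have xe : x / cutoffs n <= Num.min 1 (e / 2).
    apply: (@le_trans _ _ (x / n.+1%:R)).
      by apply: ler_wpM2l => //; rewrite lef_pV2 ?posrE ?cutoffs_gt0// cutoffs_ge.
    rewrite ler_pdivrMr// mulrC -ler_pdivrMr ?lt_min ?ltr01 ?divr_gt0//.
    apply: (@le_trans _ _ n%:R); last by rewrite ler_nat.
    by near: n; exact: nbhs_infty_ger.
  move: xe; rewrite le_min => /andP[h1 h2].
  rewrite /eta; set r := x / cutoffs n in r0 h1 h2 *.
  have -> : 1 - (1 - r) ^+ 2 = r * (2 - r) by ring.
  rewrite ger0_norm; last by rewrite mulr_ge0//; lra.
  have : r * (2 - r) <= r * 2 by rewrite ler_wpM2l//; lra.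
  by lra.
Unshelve. all: by end_near. Qed.

Lemma difc_le x : 0 <= x -> 0 <= difc eps x <= 1 + cbrt x.
Proof.
move=> x0; apply/andP; split; first by rewrite mulr_ge0 ?cbrt_ge0// ltW.
have := dif_le eps_gt0 eps_le1 x0; rewrite difcE// => h.
apply: (le_trans h); apply: cube_subadd => //; first exact: cbrt_ge0.
by rewrite !cbrtK ?expr1n// addr_ge0.
Qed.

(** The limit of [weak_cutoff] along [cutoffs], with an error [K / n.+1%:R] that is uniform for
    times near [t]. The growth conditions fit the weights x and [phi], but not [psi], whose
    derivative is unbounded. *)
Lemma weak_linear f f1 f2 C t : 0 < t -> 0 <= C ->
  (forall x, 0 <= x -> C2_at f f1 f2 x) -> f 0 = 0 ->
  (forall x, 0 <= x -> [/\ `|f x| <= C * x, `|f1 x| <= C & `|f2 x| <= C]) ->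
  is_derive t (1 : R) (fun t => \int[mu]_(x in D) (f x * cx (x, t)))
    (\int[mu]_(x in D) flux f1 f2 (x, t)).
Proof.
move=> t0 C0 fC f0 hf.
pose g1 n y := f1 y * eta (cutoffs n) y + f y * eta1 (cutoffs n) y.
pose g2 n y := f2 y * eta (cutoffs n) y + 2 * f1 y * eta1 (cutoffs n) y +
               f y * eta2 (cutoffs n) y.
pose G (n : nat) (t : R) := \int[mu]_(x in `[0, cutoffs n]) (f x * eta (cutoffs n) x * cx (x, t)).
pose dG (n : nat) (t : R) := \int[mu]_(x in `[0, cutoffs n]) flux (g1 n) (g2 n) (x, t).
have gC n x : 0 <= x -> C2_at (fun y => f y * eta (cutoffs n) y) (g1 n) (g2 n) x.
  by move=> x0; apply: C2_mul; [exact: fC|exact: C2_eta].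
have mI n : measurable (`[0, cutoffs n]%classic : set (measurableTypeR R)).
  exact: measurable_itv.
have ID n : `[0, cutoffs n]%classic `<=` D.
  exact: sub_halfline.
pose lam := 2 + (cbrt (L t))^-1.
have lam1 : 1 <= lam.
  have : 0 <= (cbrt (L t))^-1 by rewrite invr_ge0 cbrt_ge0.
  by rewrite /lam; lra.
have lamP : \forall u \near t, (cbrt (L u))^-1 <= lam.
  have cL : {for t, continuous (fun u => (cbrt (L u))^-1)}.
    apply: cvgV; first by rewrite lt0r_neq0// cbrt_gt0// (L_pos H).
    exact: (continuous_comp (cts_L H t0) (@continuous_cbrt _ _)).
  move/cvgrPdist_le : cL => /(_ _ ltr01); apply: filterS => u.
  by rewrite ler_norml /lam => /andP[]; lra.
have dricB u x : 0 <= x -> (cbrt (L u))^-1 <= lam -> `|dric (L u) x| <= lam * (1 + cbrt x).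
  move=> x0 hl; apply: le_trans (ler_normB _ _) _.
  rewrite normr1 ger0_norm ?divr_ge0 ?cbrt_ge0//.
  have := ler_wpM2l (cbrt_ge0 x) hl; lra.
have fluxi u : 0 < u -> (cbrt (L u))^-1 <= lam ->
    mu.-integrable D (EFin \o (fun x => flux f1 f2 (x, u))).
  move=> u0 hl; under eq_fun do rewrite fluxE.
  apply: (@integrable_lin _ _ (4 * (C * lam))) => // [x x0||x x0].
  - have [_ h1 h2] := C2_cts (fC x x0).
    by apply: cvgB; apply: cvgM => //; [exact: cts_difc|exact: cts_dric].
  - by rewrite !mulr_ge0//; lra.
  - have [_ h1 h2] := hf x x0; have p0 := cbrt_ge0 x.
    have /andP[a0 a1] := difc_le x0.
    have k1 := ler_norm_mul h2 (lexx `|difc eps x|).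
    rewrite (ger0_norm a0) in k1.
    have k2 := ler_norm_mul h1 (dricB u x x0 hl).
    have k3 := ler_wpM2l C0 a1.
    have px := cbrt_le_1x x0.
    have Cl : 0 <= C * lam by rewrite mulr_ge0//; lra.
    have k4 := ler_wpM2l C0 px; have k5 := ler_wpM2l Cl px.
    have k6 : C * (1 + x) * 1 <= C * (1 + x) * lam.
      by apply: ler_wpM2l => //; rewrite mulr_ge0//; lra.
    have k7 : 0 <= C * lam * x by rewrite mulr_ge0.
    have k8 : 0 <= C * x by rewrite mulr_ge0.
    apply: le_trans (ler_normB _ _) _; lra.
have [B B0 hB] := mass_bounded t0.
pose K := 24 * (C * lam) * B.
have K0 : 0 <= K by rewrite !mulr_ge0// ?ltW//; lra.
pose good u := [/\ 0 < u, (cbrt (L u))^-1 <= lam &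
  \int[mu]_(x in D) ((1 + x) * cx (x, u)) <= B].
have goodP : \forall u \near t, good u.
  near=> u; split; near: u; [exact: lt_nbhsr|exact: lamP|exact: hB].
have fluxc n u x : 0 < u -> 0 <= x -> {for x, continuous (fun y : R => flux (g1 n) (g2 n) (y, u))}.
  by move=> u0 /(gC n) /C2_cts[_ ? ?]; exact: (cts_flux_x H).
have est n u : good u -> `|dG n u - \int[mu]_(x in D) flux f1 f2 (x, u)| <= K / n.+1%:R.
  move=> [u0 hl hBu].
  have m1 : 1 <= n.+1%:R :> R by rewrite ler1n.
  have m0 : 0 < n.+1%:R :> R by rewrite ltr0n.
  set m := n.+1%:R in m1 m0 *.
  pose k (x : R) := 24 * (C * lam) / m * ((1 + x) * cx (x, u)).
  have kE x : k x = 24 * (C * lam * (1 + x) / m) * cx (x, u).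
    by rewrite /k; ring.
  have k0 : 0 <= 24 * (C * lam) / m.
    by rewrite divr_ge0 ?(ltW m0)// !mulr_ge0//; lra.
  apply: le_trans (@Rintegral_approx _ `[0, cutoffs n]%classic D _
    (fun x => flux f1 f2 (x, u)) k _ _ _ _ _ _ _ _) _ => //.
  - by apply: cts_integrable => x /andP[x0 _]; exact: fluxc.
  - exact: fluxi.
  - exact: (integrableZl mD _ (integrable_1x u0)).
  - move=> x /=; rewrite in_itv/= => /andP[x0 xN].
    rewrite !fluxE -mulrBl normrM (ger0_norm (cx_ge0 H _ u0)) kE.
    apply: ler_wpM2r; first exact: (cx_ge0 H).
    have /andP[a0 a1] := difc_le x0; have [h0 h1 h2] := hf x x0.
    have pm : cbrt x <= m.
      by apply: ler_cube; [exact: ltW|rewrite cbrtK].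
    have := @cutoff_pointwise R C lam m (cbrt x) (f x) (f1 x) (f2 x) (difc eps x)
      (dric (L u) x); rewrite cbrtK// (ger0_norm a0).
    by apply => //; [exact: cbrt_ge0|exact: dricB].
  - move=> x; rewrite halflineE/= in_itv/= => x0 /negP; rewrite x0/= -ltNge => xN.
    rewrite fluxE normrM (ger0_norm (cx_ge0 H _ u0)) kE.
    apply: ler_wpM2r; first exact: (cx_ge0 H).
    have /andP[a0 a1] := difc_le x0; have [h0 h1 h2] := hf x x0.
    have pm : m <= cbrt x.
      by apply: ler_cube; [exact: cbrt_ge0|rewrite cbrtK// ltW].
    have := @cutoff_tail R C lam m (cbrt x) (f1 x) (f2 x) (difc eps x)
      (dric (L u) x); rewrite cbrtK// (ger0_norm a0).
    by apply => //; exact: dricB.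
  - rewrite /k RintegralZl//; last exact: integrable_1x.
    rewrite (_ : K / m = 24 * (C * lam) / m * B); last by rewrite /K; ring.
    by apply: ler_wpM2l.
apply: (@is_derive_limit _ _ \oo _ G dG).
- near=> n u => /=; apply: (weak_cutoff eps_gt0 H) => //; first exact: cutoffs_gt0.
  by near: u; exact: lt_nbhsr.
- near=> u.
  have u0 : 0 < u by near: u; exact: lt_nbhsr.
  have ui : mu.-integrable D (EFin \o (fun x => f x * cx (x, u))).
    apply: (@integrable_lin _ _ C) => // x x0.
      by have [] := C2_cts (fC x x0).
    have [h _ _] := hf x x0; apply: (le_trans h).
    by apply: ler_wpM2l => //; lra.
  rewrite (_ : G ^~ u = fun n => \int[mu]_(x in `[0, cutoffs n])
      (f x * cx (x, u) * eta (cutoffs n) x)); first exact: cutoff_cvg.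
  by apply/funext => n; apply: eq_Rintegral => x _; rewrite mulrAC.
- move=> e e0.
  (* Continuity in time is obtained on a compact segment only, so one fixed cutoff [m] serves as a
     bridge: from [dG n u] to the full flux at [u], to [dG m u], to [dG m t], to the full flux at
     [t], each step costing [e / 4]. *)
  have [m hm] : exists m : nat, K / m.+1%:R <= e / 4.
    have e4 : 0 < e / 4 by rewrite divr_gt0.
    near \oo => m; exists m.
    rewrite ler_pdivrMr ?ltr0n// mulrC -ler_pdivrMr//.
    apply: (@le_trans _ _ m%:R); last by rewrite ler_nat.
    by near: m; exact: nbhs_infty_ger.
  pose e1 := e / 4 / cutoffs m.
  have e10 : 0 < e1 by rewrite !divr_gt0// cutoffs_gt0.
  have hT : \forall u \near t, forall x, 0 <= x <= cutoffs m ->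
      `|flux (g1 m) (g2 m) (x, u) - flux (g1 m) (g2 m) (x, t)| <= e1.
    apply: tube => // x /andP[x0 _].
    by have [_ ? ?] := C2_cts (gC m x x0); exact: (cts_flux H).
  have gt : good t by exact: nbhs_singleton goodP.
  near=> n u => /=.
  have gu : good u by near: u; exact: goodP.
  have hTu : forall x, 0 <= x <= cutoffs m ->
      `|flux (g1 m) (g2 m) (x, u) - flux (g1 m) (g2 m) (x, t)| <= e1.
    by near: u; exact: hT.
  have [u0 _ _] := gu.
  have mn : (m <= n)%N by near: n; exact: nbhs_infty_ge.
  have d1 : `|dG n u - \int[mu]_(x in D) flux f1 f2 (x, u)| <= e / 4.
    apply: (le_trans (est n u gu)); apply: le_trans hm.
    by apply: ler_wpM2l => //; rewrite lef_pV2 ?posrE ?ltr0n// ler_nat.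
  have d2 := le_trans (est m u gu) hm.
  have d3 := le_trans (est m t gt) hm.
  have d4 : `|dG m u - dG m t| <= e / 4.
    apply: le_trans (@Rintegral_approx _ `[0, cutoffs m]%classic `[0, cutoffs m]%classic _
      (fun x => flux (g1 m) (g2 m) (x, t)) (fun=> e1) _ _ _ _ _ _ _ _) _ => //.
    + by apply: cts_integrable => x /andP[x0 _]; exact: fluxc.
    + by apply: cts_integrable => x /andP[x0 _]; exact: fluxc.
    + by apply: cts_integrable => x _; exact: cst_continuous.
    + rewrite Rintegral_cst_itv ?cutoffs_gt0// subr0 /e1 divfK//.
      by rewrite gt_eqF// cutoffs_gt0.
  set a := dG n u in d1 *; set lu := \int[mu]_(x in D) flux f1 f2 (x, u) in d1 d2.
  set b := dG m u in d2 d4; set b' := dG m t in d3 d4; set lt_ := (X in `|_ - X| <= _).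
  have -> : a - lt_ = (a - lu) - (b - lu) + (b - b') + (b' - lt_) by ring.
  have n1 := ler_normD (a - lu - (b - lu) + (b - b')) (b' - lt_).
  have n2 := ler_normD (a - lu - (b - lu)) (b - b').
  have n3 := ler_normB (a - lu) (b - lu).
  rewrite -/lt_ in d3.
  by lra.
Unshelve. all: by end_near. Qed.

End weak_linear.

(** * Energy and moment *)

Section test_functions.
Variable R : realType.
Implicit Types (k x E : R).

Lemma cbrt_1x x : 0 <= x -> [/\ 1 <= cbrt (1 + x), cbrt (1 + x) ^+ 3 = 1 + x &
  cbrt (1 + x) <= 1 + cbrt x].
Proof.
move=> x0; have h : cbrt (1 + x) ^+ 3 = 1 + x by rewrite cbrtK// addr_ge0.
split=> //.
- by apply: ler_cube; [exact: cbrt_ge0|rewrite h expr1n lerDl].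
- by apply: cube_subadd => //; [exact: cbrt_ge0|rewrite h cbrtK// expr1n].
Qed.

(** With [r], [d] the cube roots of [k + x] and [k], factor x = r^3 - d^3; the quadratic cofactor is
    at most 2 w (r + d). The bound does not degenerate as k -> 0. *)
Lemma phi_ge x k : 0 < k -> k <= 1 -> 0 <= x ->
  3 / 4 * x <= phi k x * cbrt (1 + x).
Proof.
move=> k0 k1 x0; rewrite /phi.
have kx : k + x <= 1 + x by rewrite lerD2r.
have := ler_cbrt kx; have := cbrt_gt0 k0.
have dr : cbrt k <= cbrt (k + x) by apply: ler_cbrt; lra.
have hr : cbrt (k + x) ^+ 3 = k + x by rewrite cbrtK// addr_ge0// ltW.
have hd : cbrt k ^+ 3 = k by rewrite cbrtK// ltW.
set d := cbrt k in dr hd *; set r := cbrt (k + x) in dr hr *.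
set w := cbrt (1 + x) => d0 rw.
have xE : x = (r - d) * (r ^+ 2 + r * d + d ^+ 2).
  have -> : (r - d) * (r ^+ 2 + r * d + d ^+ 2) = r ^+ 3 - d ^+ 3 by ring.
  by rewrite hr hd; ring.
have h1 : r ^+ 2 + r * d + d ^+ 2 <= (r + d) * (2 * w).
  have e1 : (r + d) * (2 * r) <= (r + d) * (2 * w) by apply: ler_wpM2l; lra.
  have e2 : d * d <= r * d by apply: ler_wpM2r; lra.
  have e3 : 0 <= r * r by rewrite -expr2 sqr_ge0.
  by rewrite !expr2; lra.
have rd : 0 <= r - d by lra.
have := ler_wpM2l rd h1; rewrite -xE.
have -> : 3 / 2 * (r ^+ 2 - d ^+ 2) * w = 3 / 4 * ((r - d) * ((r + d) * (2 * w))).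
  by field.
by lra.
Qed.

Lemma phi_ge0 x k : 0 < k -> 0 <= x -> 0 <= phi k x.
Proof.
move=> k0 x0; have dr : cbrt k <= cbrt (k + x) by apply: ler_cbrt; lra.
by rewrite mulr_ge0// subr_ge0 lerXn2r// nnegrE cbrt_ge0.
Qed.

Lemma phi_le_sqr x k : 0 < k -> 0 <= x -> phi k x <= 3 / 2 * cbrt x ^+ 2.
Proof.
move=> k0 x0; have := @cube_sqr_subadd R (cbrt k) (cbrt x) (cbrt (k + x)).
rewrite !cbrtK ?addr_ge0 ?(ltW k0)// => /(_ (cbrt_ge0 _) (cbrt_ge0 _) erefl).
by rewrite /phi; lra.
Qed.

(** The graph of the concave function [phi k] lies below its tangent at 0, of slope 1 / [cbrt k]. *)
Lemma phi_le_lin x k : 0 < k -> 0 <= x -> phi k x * cbrt k <= x.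
Proof.
move=> k0 x0; rewrite /phi.
have dr : cbrt k <= cbrt (k + x) by apply: ler_cbrt; lra.
have hr : cbrt (k + x) ^+ 3 = k + x by rewrite cbrtK// addr_ge0// ltW.
have hd : cbrt k ^+ 3 = k by rewrite cbrtK// ltW.
have := cbrt_gt0 k0.
set d := cbrt k in dr hd *; set r := cbrt (k + x) in dr hr * => d0.
have -> : x = 3 / 2 * (r ^+ 2 - d ^+ 2) * d + (r - d) ^+ 2 * (r + d / 2).
  have -> : 3 / 2 * (r ^+ 2 - d ^+ 2) * d + (r - d) ^+ 2 * (r + d / 2) =
    r ^+ 3 - d ^+ 3 by field.
  by rewrite hr hd; ring.
by rewrite lerDl mulr_ge0 ?sqr_ge0//; lra.
Qed.

Lemma psi_bounds x : 0 <= x ->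
  [/\ 0 <= psi x, psi x <= x * cbrt x & 2 / 3 * cbrt (1 + x) * x <= x + psi x].
Proof.
move=> x0; have [w1 hw wp] := cbrt_1x x0.
have p0 := cbrt_ge0 x; rewrite /psi.
set w := cbrt (1 + x) in w1 hw wp *; set p := cbrt x in wp p0 *.
have -> : w ^+ 4 - 1 - 4 / 3 * x = (w - 1) * x + (w - 1 - 1 / 3 * x).
  by rewrite exprSr hw; field.
have xE : x = (w - 1) * (w ^+ 2 + w + 1).
  have -> : (w - 1) * (w ^+ 2 + w + 1) = w ^+ 3 - 1 by ring.
  by rewrite hw; ring.
have ww : w * 1 <= w * w by apply: ler_wpM2l; lra.
have w10 : 0 <= w - 1 by lra.
have h1 : (w - 1) * 3 <= x.
  by rewrite [leRHS]xE; apply: ler_wpM2l => //; rewrite expr2; lra.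
have h2 : x <= 3 * ((w - 1) * (1 + x)).
  rewrite -hw [leLHS]xE mulrCA; apply: ler_wpM2l => //.
  have : w * w * 1 <= w * w * w by apply: ler_wpM2l; [rewrite mulr_ge0|]; lra.
  have -> : w ^+ 3 = w * w * w by ring.
  by rewrite expr2; lra.
have h3 : (w - 1) * x <= p * x by apply: ler_wpM2r; lra.
have h4 : 1 * x <= w * x by apply: ler_wpM2r; lra.
by split; lra.
Qed.

(** The lower bounds 3/4 x / w for [phi] and 2/3 w x for x + [psi] are multiplied: the factor w
    cancels and 3/4 times 2/3 is 1/2. *)
Lemma phi_psi x k : 0 < k -> k <= 1 -> 0 <= x -> x ^+ 2 <= 2 * phi k x * (x + psi x).
Proof.
move=> k0 k1 x0; have [w1 _ _] := cbrt_1x x0; have [s0 _ s2] := psi_bounds x0.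
have h := phi_ge k0 k1 x0; have ph0 := phi_ge0 k0 x0.
set w := cbrt (1 + x) in w1 s2 h.
have w0 : 0 < w by lra.
rewrite -(ler_pM2r w0).
have e1 : 3 / 4 * x * (2 / 3 * w * x) <= phi k x * w * (x + psi x).
  by apply: ler_pM => //; rewrite mulr_ge0// mulr_ge0// ltW.
have -> : x ^+ 2 * w = 2 * (3 / 4 * x * (2 / 3 * w * x)) by field.
have -> : 2 * phi k x * (x + psi x) * w = 2 * (phi k x * w * (x + psi x)) by ring.
by lra.
Qed.

(** The geometric mean in [phi_psi] is replaced by an arithmetic one with a free parameter, so that
    the inequality can be integrated term by term. With [E] the energy itself, the first term
    integrates to 1/2. *)
Lemma interpolation x k E : 0 < k -> k <= 1 -> 0 <= x -> 0 < E ->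
  x <= phi k x / (2 * E) + E * (x + psi x).
Proof.
move=> k0 k1 x0 E0; have h := phi_psi k0 k1 x0.
have [s0 _ _] := psi_bounds x0; have ph0 := phi_ge0 k0 x0.
set u := phi k x / (2 * E); set v := E * (x + psi x).
have uv : 4 * (u * v) = 2 * phi k x * (x + psi x).
  by rewrite /u /v; field; rewrite gt_eqF.
have u0 : 0 <= u by rewrite divr_ge0// mulr_ge0// ltW.
have v0 : 0 <= v by apply: mulr_ge0; [exact: ltW|rewrite addr_ge0].
rewrite -(ler_pXn2r (isT : (0 < 2)%N)) ?nnegrE ?addr_ge0//.
apply: (le_trans h); rewrite -uv -subr_ge0.
have -> : (u + v) ^+ 2 - 4 * (u * v) = (u - v) ^+ 2 by ring.
exact: sqr_ge0.
Qed.

Lemma phi1_bounds x k : 0 < k -> 0 <= x -> 0 < phi1 k x <= (cbrt k)^-1.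
Proof.
move=> k0 x0; have d0 := cbrt_gt0 k0.
have dr : cbrt k <= cbrt (k + x) by apply: ler_cbrt; lra.
have r0 : 0 < cbrt (k + x) by lra.
by rewrite /phi1 invr_gt0 r0 lef_pV2.
Qed.

Lemma phi2_bounds x k : 0 < k -> 0 <= x -> 0 <= - phi2 k x <= (cbrt k) ^- 4.
Proof.
move=> k0 x0; have d0 := cbrt_gt0 k0.
have dr : cbrt k <= cbrt (k + x) by apply: ler_cbrt; lra.
have r0 : 0 < cbrt (k + x) by lra.
have rd : cbrt (k + x) ^- 4 <= cbrt k ^- 4.
  by rewrite lef_pV2 ?posrE ?exprn_gt0// lerXn2r// nnegrE ltW.
have r4 : 0 <= cbrt (k + x) ^- 4 by rewrite invr_ge0 exprn_ge0// ltW.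
by rewrite /phi2 opprK; apply/andP; split; lra.
Qed.

End test_functions.

(** * Dissipation of the energy *)

Section energy_dissipation.
Variables (R : realType) (eps : R) (c0 L : R -> R) (c : R -> R -> R).
Hypothesis eps_gt0 : 0 < eps.
Hypothesis eps_le1 : eps <= 1.
Hypothesis H : diffusive_LSW_solution eps c0 L c.
Notation mu := (@lebesgue_measure R).
Notation cx := (cx c).
Notation flux := (flux eps L c).
Notation D := (@halfline R).
Implicit Types (f : R -> R) (x t k l : R).
Let mD := @measurable_halfline R.

Lemma dric_lin t x : 0 < t -> 0 <= x ->
  `|dric (L t) x| <= (2 + (cbrt (L t))^-1) * (1 + x).
Proof.
move=> t0 x0; have i0 : 0 <= (cbrt (L t))^-1 by rewrite invr_ge0 cbrt_ge0.
apply: le_trans (ler_normB _ _) _.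
rewrite normr1 ger0_norm ?divr_ge0 ?cbrt_ge0//.
by have := ler_wpM2r i0 (cbrt_le_1x x0); lra.
Qed.

Lemma drift_integrable t : 0 < t ->
  mu.-integrable D (EFin \o (fun x => dric (L t) x * cx (x, t))).
Proof.
move=> t0; apply: (integrable_lin H (C := 2 + (cbrt (L t))^-1)) => //.
- by move=> x _; exact: cts_dric.
- by rewrite addr_ge0// invr_ge0 cbrt_ge0.
- by move=> x; exact: dric_lin.
Qed.

(* Conservation of mass forces the mean drift to vanish. *)
Lemma mean_drift t : 0 < t -> \int[mu]_(x in D) (dric (L t) x * cx (x, t)) = 0.
Proof.
move=> t0.
have bnd x : 0 <= x ->
    [/\ `|(id : R -> R) x| <= 1 * x, `|(cst 1 : R -> R) x| <= 1 & `|(cst 0 : R -> R) x| <= 1].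
  by move=> x0; split; rewrite /cst/= ?mul1r ?normr1 ?normr0// ger0_norm.
have h := weak_linear eps_gt0 eps_le1 H t0 ler01 (fun x _ => @C2_id R x) erefl bnd.
have h0 : is_derive t (1 : R) (fun t => \int[mu]_(x in D) (x * cx (x, t))) 0.
  have := der_cst (1 : R) t erefl; apply: near_eq_is_derive; near=> u.
  by rewrite (Rmass H)//; near: u; exact: lt_nbhsr.
have : \int[mu]_(x in D) flux (cst 1) (cst 0) (x, t) = 0.
  by case: h h0 => _ <- [_ <-].
have -> : \int[mu]_(x in D) flux (cst 1) (cst 0) (x, t) =
   \int[mu]_(x in D) (-1 * (dric (L t) x * cx (x, t))).
  by apply: eq_Rintegral => x _; rewrite fluxE /cst; ring.
rewrite RintegralZl//; last exact: drift_integrable.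
by rewrite mulN1r => /eqP; rewrite oppr_eq0 => /eqP.
Unshelve. all: by end_near. Qed.

Section energy.
Variable k : R.
Hypothesis k_gt0 : 0 < k.
Hypothesis k_le1 : k <= 1.

Definition energy t := \int[mu]_(x in D) (phi k x * cx (x, t)).

(** A multiple [phi1 k (L t)] of the drift, whose mean vanishes, has been subtracted. Both factors
    of the first product then change sign at [x = L t], which makes the density nonnegative. *)
Definition dissipation t x :=
  (phi1 k x - phi1 k (L t)) * dric (L t) x - phi2 k x * difc eps x.

Definition total_dissipation t := \int[mu]_(x in D) (dissipation t x * cx (x, t)).

Lemma C2_phi_ge0 x : 0 <= x -> C2_at (phi k) (phi1 k) (phi2 k) x.
Proof. by move=> x0; apply: C2_phi; rewrite ltr_wpDr. Qed.

Lemma phi_lin x : 0 <= x -> `|phi k x| <= (cbrt k)^-1 * x.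
Proof.
move=> x0; rewrite ger0_norm ?phi_ge0// mulrC ler_pdivlMr ?cbrt_gt0//.
exact: phi_le_lin.
Qed.

Lemma energy_integrable t : 0 < t ->
  mu.-integrable D (EFin \o (fun x => phi k x * cx (x, t))).
Proof.
move=> t0; have i0 : 0 <= (cbrt k)^-1 by rewrite invr_ge0 cbrt_ge0.
apply: (integrable_lin H (C := (cbrt k)^-1)) => // x x0.
- by have [] := C2_cts (C2_phi_ge0 x0).
- by apply: le_trans (phi_lin x0) _; rewrite ler_wpM2l// lerDr.
Qed.

Lemma dissipation_integrable t : 0 < t ->
  mu.-integrable D (EFin \o (fun x => dissipation t x * cx (x, t))).
Proof.
move=> t0; have Lt := L_pos H t0; have l0 := cbrt_gt0 Lt; have d0 := cbrt_gt0 k_gt0.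
pose A := (cbrt k)^-1; pose B := cbrt k ^- 4; pose i := (cbrt (L t))^-1.
have A0 : 0 <= A by rewrite invr_ge0 ltW.
have B0 : 0 <= B by rewrite invr_ge0 exprn_ge0// ltW.
have i0 : 0 <= i by rewrite invr_ge0 ltW.
apply: (integrable_lin H (C := 2 * A * (2 + i) + 2 * B)) => //.
- move=> x x0; have [_ h1 h2] := C2_cts (C2_phi_ge0 x0).
  apply: cvgB; apply: cvgM => //.
  + by apply: cvgB => //; exact: cvg_cst.
  + exact: cts_dric.
  + exact: cts_difc.
- by rewrite addr_ge0// !mulr_ge0// addr_ge0.
- move=> x x0; rewrite /dissipation.
  have /andP[a0 a1] := difc_le eps_gt0 eps_le1 x0.
  have /andP[b0 b1] := phi1_bounds k_gt0 x0.
  have /andP[e0 e1] := phi1_bounds k_gt0 (ltW Lt).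
  have /andP[g0 g1] := phi2_bounds k_gt0 x0.
  have n1 : `|phi1 k x - phi1 k (L t)| <= 2 * A.
    by rewrite ler_norml /A; apply/andP; split; lra.
  have n2 : `|dric (L t) x| <= (2 + i) * (1 + x) by exact: dric_lin.
  have n3 : `|phi2 k x| <= B by rewrite ler_norml /B; apply/andP; split; lra.
  have n4 : `|difc eps x| <= 2 * (1 + x).
    by have := cbrt_le_1x x0; rewrite ger0_norm//; lra.
  apply: le_trans (ler_normB _ _) _.
  have := lerD (ler_norm_mul n1 n2) (ler_norm_mul n3 n4); lra.
Qed.

Lemma energy_derive t : 0 < t ->
  is_derive t (1 : R) energy (- total_dissipation t).
Proof.
move=> t0; have Lt := L_pos H t0; have l0 := cbrt_gt0 Lt; have d0 := cbrt_gt0 k_gt0.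
pose C := (cbrt k)^-1 + (cbrt k) ^- 4.
have A0 : 0 <= (cbrt k)^-1 by rewrite invr_ge0 ltW.
have B0 : 0 <= cbrt k ^- 4 by rewrite invr_ge0 exprn_ge0// ltW.
have C0 : 0 <= C by rewrite addr_ge0.
have bnd x : 0 <= x -> [/\ `|phi k x| <= C * x, `|phi1 k x| <= C & `|phi2 k x| <= C].
  move=> x0; have /andP[b0 b1] := phi1_bounds k_gt0 x0.
  have /andP[g0 g1] := phi2_bounds k_gt0 x0; split.
  - apply: le_trans (phi_lin x0) _; apply: ler_wpM2r => //; rewrite /C; lra.
  - by rewrite ger0_norm /C; lra.
  - by rewrite ler_norml /C; apply/andP; split; lra.
have p0 : phi k 0 = 0 by rewrite /phi addr0 subrr mulr0.
have h := weak_linear eps_gt0 eps_le1 H t0 C0 C2_phi_ge0 p0 bnd.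
apply: (is_derive_eq h).
have di := dissipation_integrable t0.
have mi0 := drift_integrable t0.
have mi : mu.-integrable D (EFin \o (fun x => phi1 k (L t) * (dric (L t) x * cx (x, t)))).
  exact: (integrableZl mD (phi1 k (L t)) mi0).
have -> : \int[mu]_(x in D) flux (phi1 k) (phi2 k) (x, t) =
  \int[mu]_(x in D) (-1 * (dissipation t x * cx (x, t)) -
                     phi1 k (L t) * (dric (L t) x * cx (x, t))).
  by apply: eq_Rintegral => x _; rewrite fluxE /dissipation; ring.
rewrite RintegralB//; last exact: (integrableZl mD (-1) di).
rewrite RintegralZl// RintegralZl//.
by rewrite mean_drift// mulr0 subr0 mulN1r.
Qed.

Lemma drift_dissipation_ge0 l x : 0 < l -> 0 <= x ->
  0 <= (phi1 k x - phi1 k l) * dric l x.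
Proof.
move=> l0 x0; have cl0 := cbrt_gt0 l0.
have r0 y : 0 <= y -> 0 < cbrt (k + y) by move=> y0; rewrite cbrt_gt0// ltr_wpDr.
have [xl|lx] := leP x l.
  apply: mulr_ge0; rewrite subr_ge0.
    by rewrite /phi1 lef_pV2 ?posrE ?r0// ?ler_cbrt ?lerD2l// ltW.
  by rewrite ler_pdivrMr// mul1r ler_cbrt.
apply: mulr_le0; rewrite subr_le0.
  by rewrite /phi1 lef_pV2 ?posrE ?r0// ?ler_cbrt ?lerD2l// ltW.
by rewrite ler_pdivlMr// mul1r ler_cbrt// ltW.
Qed.

Lemma dissipation_ge0 t x : 0 < t -> 0 <= x -> 0 <= dissipation t x.
Proof.
move=> t0 x0; have Lt := L_pos H t0.
have /andP[g0 _] := phi2_bounds k_gt0 x0.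
have /andP[a0 _] := difc_le eps_gt0 eps_le1 x0.
rewrite /dissipation -mulNr; apply: addr_ge0; last exact: mulr_ge0.
exact: drift_dissipation_ge0.
Qed.

Lemma total_dissipation_ge0 t : 0 < t -> 0 <= total_dissipation t.
Proof.
move=> t0; apply: Rintegral_ge0 => x; rewrite halflineE => x0.
by rewrite mulr_ge0 ?dissipation_ge0 ?(cx_ge0 H).
Qed.

End energy.

End energy_dissipation.

Lemma le_Rintegral_sub (R : realType) (A D : set (measurableTypeR R)) (f h : R -> R) :
  measurable A -> measurable D -> A `<=` D ->
  lebesgue_measure.-integrable A (EFin \o f) ->
  lebesgue_measure.-integrable D (EFin \o h) ->
  (forall x, A x -> f x <= h x) -> (forall x, D x -> 0 <= h x) ->
  \int[lebesgue_measure]_(x in A) f x <= \int[lebesgue_measure]_(x in D) h x.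
Proof.
move=> mA mD AD fi hi fh h0.
have -> : \int[lebesgue_measure]_(x in A) f x = \int[lebesgue_measure]_(x in D) (f \_ A) x.
  by rewrite -Rintegral_mkcondr setIidr.
apply: le_Rintegral => //.
  by rewrite -restrict_EFin; apply/integrable_restrict => //; rewrite setIidr.
move=> x Dx; rewrite patchE; case: ifPn => [|_]; first by rewrite inE => /fh.
exact: h0.
Qed.

(** * Evolution of the cut moment and interpolation *)

Section moment.
Variables (R : realType) (eps : R) (c0 L : R -> R) (c : R -> R -> R).
Hypothesis eps_gt0 : 0 < eps.
Hypothesis eps_le1 : eps <= 1.
Hypothesis H : diffusive_LSW_solution eps c0 L c.
Notation mu := (@lebesgue_measure R).
Notation cx := (cx c).
Notation flux := (flux eps L c).
Notation D := (@halfline R).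
Implicit Types (f : R -> R) (x t E : R).
Variable k : R.
Hypothesis k_gt0 : 0 < k.
Hypothesis k_le1 : k <= 1.
Let mD := @measurable_halfline R.

Definition moment (n : nat) t :=
  \int[mu]_(x in `[0, cutoffs R n]) (psi x * eta (cutoffs R n) x * cx (x, t)).

Definition cut_mass (n : nat) t :=
  \int[mu]_(x in `[0, cutoffs R n]) (x * eta (cutoffs R n) x * cx (x, t)).

Lemma C2_psi_ge0 x : 0 <= x -> C2_at (@psi R) (@psi1 R) (@psi2 R) x.
Proof. by move=> x0; apply: C2_psi; rewrite ltr_wpDr. Qed.

(** Five terms: [t1] and [t4] come from the two pointwise comparisons and cost 8 E^2 x each. The
    term [t2] has a sign, as [psi] increases while [eta] decreases. The remaining [t3] and [t5] are
    cutoff errors, 4 + 2 = 6 over [n.+1], because [psi] is at most x^(4/3) and N is the cube of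
    [n.+1]. *)
Lemma moment_coef n x t E : 0 < t -> k <= L t -> 0 <= x <= cutoffs R n -> 0 < E ->
  (psi2 x * eta (cutoffs R n) x + 2 * psi1 x * eta1 (cutoffs R n) x +
   psi x * eta2 (cutoffs R n) x) * difc eps x -
  (psi1 x * eta (cutoffs R n) x + psi x * eta1 (cutoffs R n) x) * dric (L t) x <=
  (3 + (4 * E ^+ 2)^-1) * dissipation eps L k t x + (16 * E ^+ 2 + 6 / n.+1%:R) * x.
Proof.
move=> t0 kL xN E0; have /andP[x0 xN'] := xN.
have Lt := L_pos H t0; have l0 := cbrt_gt0 Lt.
have [w1 hw wp] := cbrt_1x x0; have [s0 s1 _] := psi_bounds x0.
have /andP[a0 a1] := difc_le eps_gt0 eps_le1 x0.
have aw : difc eps x <= cbrt (1 + x) by rewrite -difcE// dif_le.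
have p0 := cbrt_ge0 x.
have r0 : 0 < cbrt (k + x) by rewrite cbrt_gt0// ltr_wpDr.
have rw : cbrt (k + x) <= cbrt (1 + x) by rewrite ler_cbrt// lerD2r.
have m1 : 1 <= n.+1%:R :> R by rewrite ler1n.
set m := n.+1%:R in m1 *.
have m0 : 0 < m by exact: lt_le_trans m1.
have N0 := cutoffs_gt0 R n.
have pm : cbrt x <= m by apply: ler_cube; [exact: ltW|rewrite cbrtK].
have /andP[e0 e1] := eta01 N0 xN.
pose e := (4 * E ^+ 2)^-1.
have e_ge0 : 0 <= e by rewrite invr_ge0 mulr_ge0// sqr_ge0.
pose d1 := (phi1 k x - phi1 k (L t)) * dric (L t) x.
pose d2 := 1 / 3 * cbrt (k + x) ^- 4 * difc eps x.
have dE : dissipation eps L k t x = d1 + d2 by rewrite /dissipation /phi2 /d1 /d2; ring.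
have d20 : 0 <= d2.
  apply: mulr_ge0 => //; apply: mulr_ge0 => //.
  by rewrite invr_ge0 exprn_ge0 ?cbrt_ge0.
have rk0 : 0 < cbrt (k + L t) by rewrite cbrt_gt0// addr_gt0.
have dr := @drift_pointwise R (cbrt k) (cbrt x) (cbrt (L t)) (cbrt (k + x))
  (cbrt (k + L t)) (cbrt (1 + x)) E (cbrt_gt0 k_gt0) (ler_cbrt kL) p0 r0 rk0.
rewrite !cbrtK ?addr_ge0 ?(ltW k_gt0) ?(ltW Lt)// in dr.
have {dr} := dr erefl erefl (lt_le_trans ltr01 w1) erefl E0.
have := diffusion_pointwise x0 r0 rw hw a0 aw E0.
rewrite -/e -/d2 -/(psi2 x) -/(psi1 x) -/(phi1 k x) -/(phi1 k (L t)) -/(dric (L t) x) -/d1.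
move=> I5 I4.
have d10 : 0 <= d1 by exact: drift_dissipation_ge0.
have psi10 : 0 <= psi1 x by rewrite /psi1 mulr_ge0// subr_ge0.
have psi20 : 0 <= psi2 x by rewrite /psi2 mulr_ge0// invr_ge0 exprn_ge0// cbrt_ge0.
set N := cutoffs R n in N0 xN xN' e0 e1 *.
have z0 : 0 <= 1 - x / N by rewrite subr_ge0 ler_pdivrMr// mul1r.
have z1 : 1 - x / N <= 1 by rewrite gerBl divr_ge0// ltW.
have iN0 : 0 < N^-1 by rewrite invr_gt0.
have Ex : 0 <= 8 * E ^+ 2 * x by rewrite mulr_ge0// mulr_ge0// sqr_ge0.
have t1 : psi2 x * eta N x * difc eps x <= (3 + e) * d2 + 8 * E ^+ 2 * x.
  apply: le_trans I5; rewrite mulrAC; apply: ler_piMr => //; exact: mulr_ge0.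
have t2 : 2 * psi1 x * eta1 N x * difc eps x <= 0.
  have : 0 <= 2 * psi1 x * (2 / N * (1 - x / N)) * difc eps x.
    have i0 := ltW iN0.
    apply: mulr_ge0 => //; apply: mulr_ge0; first by rewrite mulr_ge0.
    by apply: mulr_ge0 => //; rewrite mulr_ge0.
  by rewrite /eta1 !mulNr mulrN mulNr oppr_le0.
have pN : cbrt x * N^-1 <= m^-1.
  have -> : m^-1 = m ^+ 2 * N^-1.
    by rewrite /N /cutoffs -/m; field; rewrite gt_eqF.
  apply: ler_wpM2r; first exact: ltW.
  by apply: (le_trans pm); rewrite -[leLHS]expr1 ler_weXn2l.
have im0 : 0 < m^-1 by rewrite invr_gt0.
have g2 : psi x * N^-1 <= m^-1 * x.
  apply: (@le_trans _ _ (x * cbrt x * N^-1)).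
    by apply: ler_wpM2r => //; exact: ltW.
  by rewrite -mulrA mulrC; apply: ler_wpM2r.
have t3 : psi x * eta2 N x * difc eps x <= 4 * (m^-1 * x).
  have g1 : (1 + cbrt x) * N^-1 <= 2.
    have mN : m <= N by exact: cutoffs_ge.
    rewrite ler_pdivrMr// mulr_natl mulr2n lerD ?(le_trans m1)//.
    exact: le_trans pm mN.
  have -> : psi x * eta2 N x * difc eps x =
    2 * ((psi x * N^-1) * (difc eps x * N^-1)).
    by rewrite /eta2; field; rewrite gt_eqF.
  have g3 : difc eps x * N^-1 <= 2.
    by apply: le_trans g1; apply: ler_wpM2r => //; exact: ltW.
  rewrite (_ : 4 * _ = 2 * (m^-1 * x * 2)); last by ring.
  by apply: ler_wpM2l => //; apply: ler_pM => //; rewrite mulr_ge0// ltW.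
have t4 : - (psi1 x * eta N x * dric (L t) x) <= e * d1 + 8 * E ^+ 2 * x.
  have rhs0 : 0 <= e * d1 + 8 * E ^+ 2 * x by rewrite addr_ge0// mulr_ge0.
  have -> : - (psi1 x * eta N x * dric (L t) x) = eta N x * - (psi1 x * dric (L t) x).
    by ring.
  have [neg|pos] := leP (- (psi1 x * dric (L t) x)) 0.
    by apply: le_trans rhs0; apply: mulr_ge0_le0.
  by apply: le_trans I4; apply: ler_piMl => //; exact: ltW.
have t5 : - (psi x * eta1 N x * dric (L t) x) <= 2 * (m^-1 * x).
  have -> : - (psi x * eta1 N x * dric (L t) x) =
    2 * (psi x * N^-1 * ((1 - x / N) * dric (L t) x)).
    by rewrite /eta1; ring.
  have g3 : (1 - x / N) * dric (L t) x <= 1.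
    have b1 : dric (L t) x <= 1 by rewrite /dric gerBl divr_ge0 ?cbrt_ge0.
    have [neg|pos] := leP (dric (L t) x) 0.
      by apply: (@le_trans _ _ 0) => //; apply: mulr_ge0_le0.
    by rewrite -[leRHS]mulr1; apply: ler_pM => //; exact: ltW.
  have s2 : 0 <= psi x * N^-1 by rewrite mulr_ge0// ltW.
  have : psi x * N^-1 * ((1 - x / N) * dric (L t) x) <= psi x * N^-1 * 1.
    exact: ler_wpM2l.
  by rewrite mulr1 => h; rewrite ler_wpM2l//; exact: le_trans h g2.
rewrite dE -/e; have ed : 0 <= 3 * d1 by rewrite mulr_ge0.
have := lerD (lerD (lerD (lerD t1 t2) t3) t4) t5.
set lhs := (X in X <= _); set rhs := (X in _ <= X) => h.
have -> : (psi2 x * eta N x + 2 * psi1 x * eta1 N x + psi x * eta2 N x) *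
    difc eps x - (psi1 x * eta N x + psi x * eta1 N x) * dric (L t) x = lhs.
  by rewrite /lhs; ring.
apply: (le_trans h); rewrite -subr_ge0.
suff -> : (3 + e) * (d1 + d2) + (16 * E ^+ 2 + 6 / m) * x - rhs = 3 * d1 by [].
by rewrite /rhs; ring.
Qed.

Lemma moment_derive n t : 0 < t -> exists2 dM,
  is_derive t (1 : R) (moment n) dM &
  k <= L t -> forall E, 0 < E ->
  dM <= (3 + (4 * E ^+ 2)^-1) * total_dissipation eps L c k t + 16 * E ^+ 2 + 6 / n.+1%:R.
Proof.
move=> t0.
have psi0 : psi (0 : R) = 0.
  by rewrite /psi addr0 mulr0 subr0 (@cbrt_uniq _ _ 1)// ?expr1n// subrr.
have N0 := cutoffs_gt0 R n.
eexists; first exact: (weak_cutoff eps_gt0 H N0 t0 C2_psi_ge0 psi0).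
move=> kL E E0.
have di := dissipation_integrable eps_gt0 eps_le1 H k_gt0 t0.
have mi := integrable_mass H t0.
set q := 3 + _; set b := 16 * E ^+ 2 + 6 / n.+1%:R.
have q0 : 0 <= q by rewrite addr_ge0// invr_ge0 mulr_ge0// sqr_ge0.
have b0 : 0 <= b.
  apply: addr_ge0; first by rewrite mulr_ge0// sqr_ge0.
  by rewrite divr_ge0// ler0n.
have i1 := integrableZl mD q di; have i2 := integrableZl mD b mi.
have -> : q * total_dissipation eps L c k t + 16 * E ^+ 2 + 6 / n.+1%:R =
    \int[mu]_(x in D) (q * (dissipation eps L k t x * cx (x, t)) + b * (x * cx (x, t))).
  rewrite (@RintegralD _ _ _ mu D (fun x => q * (dissipation eps L k t x * cx (x, t)))
    (fun x => b * (x * cx (x, t))))//.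
  by rewrite !RintegralZl// (Rmass H)// mulr1 /b addrA.
apply: le_Rintegral_sub => //.
- exact: sub_halfline.
- apply: cts_integrable => x /andP[x0 _].
  have /C2_cts[_ h1 h2] := C2_mul (C2_psi_ge0 x0) (C2_eta (cutoffs R n) x).
  exact: (cts_flux_x H).
- exact: (integrableD mD i1 i2).
- move=> x /=; rewrite in_itv/= => xN.
  have -> : q * (dissipation eps L k t x * cx (x, t)) + b * (x * cx (x, t)) =
      (q * dissipation eps L k t x + b * x) * cx (x, t) by ring.
  rewrite fluxE; apply: ler_wpM2r; first exact: (cx_ge0 H).
  exact: moment_coef.
- move=> x; rewrite halflineE => x0.
  have cx0 := cx_ge0 H x t0.
  by rewrite addr_ge0// !mulr_ge0// (dissipation_ge0 eps_gt0 eps_le1 H).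
Qed.

Lemma cut_mass_cvg t : 0 < t -> cut_mass n t @[n --> \oo] --> (1 : R).
Proof.
move=> t0; rewrite -(Rmass H t0).
rewrite (_ : cut_mass ^~ t = fun n => \int[mu]_(x in `[0, cutoffs R n])
    (x * cx (x, t) * eta (cutoffs R n) x)).
  by apply: cutoff_cvg; exact: (integrable_mass H).
by apply/funext => n; apply: eq_Rintegral => x _; rewrite mulrAC.
Qed.

Lemma cut_integrable f n t : 0 < t -> (forall x, 0 <= x -> {for x, continuous f}) ->
  mu.-integrable `[0, cutoffs R n]
    (EFin \o (fun x => f x * eta (cutoffs R n) x * cx (x, t))).
Proof.
move=> t0 cf; apply: cts_integrable => x /andP[x0 _].
apply: cvgM; last exact: (cts_cx_x H).
apply: cvgM; first exact: cf.
by have [] := C2_cts (C2_eta (cutoffs R n) x).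
Qed.

(** On each [0, N] the weight x is at most a multiple of [phi k x]; without positive energy all cut
    masses would be nonpositive, whereas they tend to 1. *)
Lemma energy_gt0 t : 0 < t -> 0 < energy c k t.
Proof.
move=> t0; rewrite ltNge; apply/negP => E0.
have cm n : cut_mass n t <= 0.
  have N0 := cutoffs_gt0 R n.
  pose q := 4 / 3 * cbrt (1 + cutoffs R n).
  have q0 : 0 <= q by rewrite mulr_ge0// cbrt_ge0.
  have ei := energy_integrable H k_gt0 t0.
  apply: (@le_trans _ _ (q * energy c k t)); last exact: mulr_ge0_le0.
  rewrite /energy -RintegralZl//; apply: le_Rintegral_sub => //.
  - exact: sub_halfline.
  - by apply: cut_integrable => // x _; exact: cvg_id.
  - exact: (integrableZl mD q ei).
  - move=> x /=; rewrite in_itv/= => xN; have /andP[x0 xN'] := xN.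
    rewrite mulrA; apply: ler_wpM2r; first exact: (cx_ge0 H).
    have /andP[e0 e1] := eta01 N0 xN.
    apply: (@le_trans _ _ x); first exact: ler_piMr.
    have h := phi_ge k_gt0 k_le1 x0.
    have h2 : phi k x * cbrt (1 + x) <= phi k x * cbrt (1 + cutoffs R n).
      by apply: ler_wpM2l; [exact: phi_ge0|rewrite ler_cbrt// lerD2l].
    by rewrite /q; lra.
  - move=> x; rewrite halflineE => x0.
    by rewrite mulr_ge0// mulr_ge0 ?phi_ge0// (cx_ge0 H).
have : (1 : R) <= 0.
  have cv := cut_mass_cvg t0.
  by apply: (cvgr_to_le cv); near=> n; exact: cm.
by rewrite ler10.
Unshelve. all: by end_near. Qed.

(** [interpolation] at the energy, multiplied by [eta]. The cutoff is kept on [psi], where it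
    produces [moment n], and dropped on the other, nonnegative terms. *)
Lemma cut_mass_le n t : 0 < t ->
  cut_mass n t <= 1 / 2 + energy c k t * (1 + moment n t).
Proof.
move=> t0; have E0 := energy_gt0 t0.
set E := energy c k t in E0 *.
have N0 := cutoffs_gt0 R n.
have ei := energy_integrable H k_gt0 t0.
have mi := integrable_mass H t0.
have pi_ : mu.-integrable `[0, cutoffs R n]
    (EFin \o (fun x => psi x * eta (cutoffs R n) x * cx (x, t))).
  by apply: cut_integrable => // x /C2_psi_ge0/C2_cts[].
have xi : mu.-integrable `[0, cutoffs R n]
    (EFin \o (fun x => x * eta (cutoffs R n) x * cx (x, t))).
  by apply: cut_integrable => // x _; exact: cvg_id.
have mI : measurable (`[0, cutoffs R n]%classic : set (measurableTypeR R)).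
  exact: measurable_itv.
rewrite mulrDr mulr1 addrA -lerBlDr.
have -> : cut_mass n t - E * moment n t = \int[mu]_(x in `[0, cutoffs R n])
   (x * eta (cutoffs R n) x * cx (x, t) - E * (psi x * eta (cutoffs R n) x * cx (x, t))).
  rewrite RintegralB//; last exact: (integrableZl mI E pi_).
  by rewrite RintegralZl.
have i1 := integrableZl mD (2 * E)^-1 ei; have i2 := integrableZl mD E mi.
have -> : 1 / 2 + E = \int[mu]_(x in D)
    ((2 * E)^-1 * (phi k x * cx (x, t)) + E * (x * cx (x, t))).
  rewrite (@RintegralD _ _ _ mu D (fun x => (2 * E)^-1 * (phi k x * cx (x, t)))
    (fun x => E * (x * cx (x, t))))//.
  rewrite !RintegralZl// (Rmass H)// mulr1 -/(energy c k t) -/E; congr (_ + _).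
  by field; rewrite gt_eqF.
apply: le_Rintegral_sub => //.
- exact: sub_halfline.
- exact: (integrableB mI xi (integrableZl mI E pi_)).
- exact: (integrableD mD i1 i2).
- move=> x /=; rewrite in_itv/= => xN; have /andP[x0 xN'] := xN.
  set h0 := eta (cutoffs R n) x.
  have -> : x * h0 * cx (x, t) - E * (psi x * h0 * cx (x, t)) =
      (x * h0 - E * (psi x * h0)) * cx (x, t) by ring.
  have -> : (2 * E)^-1 * (phi k x * cx (x, t)) + E * (x * cx (x, t)) =
      (phi k x / (2 * E) + E * x) * cx (x, t) by ring.
  apply: ler_wpM2r; first exact: (cx_ge0 H).
  have /andP[e0 e1] := eta01 N0 xN.
  have h := interpolation k_gt0 k_le1 x0 E0.
  have ph0 := phi_ge0 k_gt0 x0.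
  have rhs0 : 0 <= phi k x / (2 * E) + E * x.
    by apply: addr_ge0; [rewrite divr_ge0// mulr_ge0// ltW|rewrite mulr_ge0// ltW].
  apply: (@le_trans _ _ (h0 * (phi k x / (2 * E) + E * x))).
    by have := ler_wpM2l e0 h; rewrite -/h0; lra.
  exact: ler_piMl.
- move=> x; rewrite halflineE => x0.
  have cx0 := cx_ge0 H x t0; have ph0 := phi_ge0 k_gt0 x0.
  have i0 : 0 <= (2 * E)^-1 by rewrite invr_ge0 mulr_ge0// ltW.
  apply: addr_ge0; first by apply: mulr_ge0 => //; exact: mulr_ge0.
  by apply: mulr_ge0; [exact: ltW|exact: mulr_ge0].
Qed.

Lemma energy_le t : 0 < t ->
  energy c k t <= 3 / 2 * (1 + \int[mu]_(x in D) cx (x, t)).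
Proof.
move=> t0.
have i1 : mu.-integrable D (EFin \o (fun x => 1 * cx (x, t))).
  apply: (integrable_lin H t0 (C := 1)) => // x x0.
    exact: cst_continuous.
  by rewrite normr1 mul1r lerDl.
have mi := integrable_mass H t0.
have -> : \int[mu]_(x in D) cx (x, t) = \int[mu]_(x in D) (1 * cx (x, t)).
  by apply: eq_Rintegral => x _; rewrite mul1r.
rewrite addrC -[X in _ + X](Rmass H t0).
rewrite -(@RintegralD _ _ _ mu D (fun x => 1 * cx (x, t)) (fun x => x * cx (x, t)))//.
have ii := integrableD mD i1 mi.
rewrite -RintegralZl//; apply: le_Rintegral => //.
- exact: (energy_integrable H k_gt0 t0).
- exact: (integrableZl mD (3 / 2) ii).
- move=> x; rewrite halflineE => x0.
  rewrite -mulrDl mulrA; apply: ler_wpM2r; first exact: (cx_ge0 H).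
  apply: le_trans (phi_le_sqr k_gt0 x0) _; apply: ler_wpM2l => //.
  have p0 := cbrt_ge0 x.
  have [p1|p1] := leP (cbrt x) 1.
    by have : cbrt x ^+ 2 <= 1 by [rewrite expr_le1]; lra.
  have : cbrt x ^+ 2 <= cbrt x ^+ 3 by rewrite ler_weXn2l// ltW.
  by rewrite cbrtK//; lra.
Qed.

End moment.

(** * Behaviour at the initial time *)

Section nonneg_integral.
Local Open Scope ereal_scope.
Context d (T : measurableType d) (R : realType) (mu : {measure set T -> \bar R}).

(* No measurability is assumed: the integral of a nonnegative function is a
   supremum over simple functions. *)
Lemma ge0_le_integral_sub (A D : set T) (f g : T -> \bar R) : A `<=` D ->
  (forall x, A x -> 0 <= f x) -> (forall x, D x -> 0 <= g x) ->
  (forall x, A x -> f x <= g x) ->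
  \int[mu]_(x in A) f x <= \int[mu]_(x in D) g x.
Proof.
move=> AD f0 g0 fg; rewrite (integral_mkcond A) (integral_mkcond D).
have f0' x : 0 <= (f \_ A) x by exact: erestrict_ge0.
have g0' x : 0 <= (g \_ D) x by exact: erestrict_ge0.
have le x : (f \_ A) x <= (g \_ D) x.
  rewrite [leLHS]patchE; case: ifPn => [|_]; last exact: g0'.
  by rewrite inE => Ax; rewrite patchE mem_set; [exact: fg|exact: AD].
rewrite !ge0_integralTE//; apply: le_ereal_sup => y [h hf <-].
by exists h => // x; exact: le_trans (hf x) (le x).
Qed.

End nonneg_integral.

Section initial.
Variables (R : realType) (eps : R) (c0 L : R -> R) (c : R -> R -> R) (M0 : R).
Hypothesis eps_gt0 : 0 < eps.
Hypothesis eps_le1 : eps <= 1.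
Hypothesis H : diffusive_LSW_solution eps c0 L c.
Notation mu := (@lebesgue_measure R).
Notation cx := (cx c).
Notation D := (@halfline R).
Implicit Types (f w : R -> R) (x t k : R).
Hypothesis c0_meas : measurable_fun D c0.
Hypothesis c0_ge0 : forall x, 0 <= x -> 0 <= c0 x.
Hypothesis c0_mass : (\int[mu]_(x in D) (x * c0 x)%:E = 1)%E.
Hypothesis c0_moment : (\int[mu]_(x in D) ((1 + x `^ (4 / 3)) * c0 x)%:E = M0%:E)%E.
Let mD := @measurable_halfline R.

Lemma le_1p43 x : 0 <= x -> [/\ x <= 1 + x `^ (4 / 3), x `^ (2 / 3) <= 1 + x `^ (4 / 3),
  x `^ (2 / 3) <= 1 + x & 1 <= 1 + x `^ (4 / 3)].
Proof.
move=> x0; rewrite powR23// powR43//; have p0 := cbrt_ge0 x.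
have {2 4}-> : x = cbrt x ^+ 3 by rewrite cbrtK.
have p4 : 0 <= cbrt x ^+ 4 by rewrite exprn_ge0.
have p3 : 0 <= cbrt x ^+ 3 by rewrite exprn_ge0.
have [p1|p1] := leP (cbrt x) 1.
  have h3 : cbrt x ^+ 3 <= 1 by rewrite expr_le1.
  have h2 : cbrt x ^+ 2 <= 1 by rewrite expr_le1.
  by rewrite cbrtK// in h3 *; split; lra.
have h3 : cbrt x ^+ 3 <= cbrt x ^+ 4 by rewrite ler_weXn2l// ltW.
have h2 : cbrt x ^+ 2 <= cbrt x ^+ 4 by rewrite ler_weXn2l// ltW.
have h1 : cbrt x ^+ 2 <= cbrt x ^+ 3 by rewrite ler_weXn2l// ltW.
by rewrite cbrtK// in h3 h1 *; split; lra.
Qed.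

Lemma meas_1p43 : measurable_fun D (fun x : R => (1 + x `^ (4 / 3)) * c0 x).
Proof.
apply: measurable_funM => //; apply: measurable_funD => //.
by apply: measurable_funTS; exact: measurable_powR.
Qed.

(** Allows additive constants to be absorbed into multiples of [M0]. *)
Lemma M0_ge1 : 1 <= M0.
Proof.
rewrite -lee_fin -c0_mass -c0_moment; apply: ge0_le_integral_sub => // x; rewrite halflineE => x0.
- by rewrite lee_fin mulr_ge0// c0_ge0.
- by rewrite lee_fin mulr_ge0 ?c0_ge0// addr_ge0// powR_ge0.
- have [h _ _ _] := le_1p43 x0.
  by rewrite lee_fin ler_wpM2r// c0_ge0.
Qed.

Lemma initial_L1 (e : R) : 0 < e -> \forall t \near 0^'+,
  (\int[mu]_(x in D) (`|c x t - c0 x|)%:E <= e%:E)%E.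
Proof.
move=> e0; have /fine_cvgP[h1 h2] := LSW_initial_L1 H.
move/cvgrPdist_le : h2 => /(_ _ e0) h2.
near=> t.
have t0 : 0 < t by near: t; exact: nbhs_right_gt.
have fn : (\int[mu]_(x in `]0%R, +oo[) (`|c x t - c0 x|)%:E)%E \is a fin_num.
  by near: t; exact: h1.
have : `|0 - fine (\int[mu]_(x in `]0%R, +oo[) (`|c x t - c0 x|)%:E)%E| <= e.
  by near: t; exact: h2.
rewrite sub0r normrN => h3.
rewrite -integral_itv_obnd_cbnd; last first.
  apply/measurable_EFinP; apply: measurableT_comp => //.
  apply: measurable_funB; last first.
    apply: measurable_funS c0_meas => // x /=.
    by rewrite halflineE in_itv/= andbT => /ltW.
  have := meas_mul_cx H (f := fun=> 1) t0 (fun x _ => @cst_continuous _ _ _ _).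
  move=> h; have {}h : measurable_fun D (fun x => c x t).
    apply: eq_measurable_fun h => x; rewrite in_halfline => x0.
    by rewrite mul1r cxE.
  apply: measurable_funS h => // x /=.
  by rewrite halflineE in_itv/= andbT => /ltW.
rewrite -(fineK fn) lee_fin; apply: le_trans h3; exact: ler_norm.
Unshelve. all: by end_near. Qed.

(** Convergence in L^1 controls only bounded weights: once the L^1 distance to [c0] is at most 1/K,
    the error is at most 1. How small [t] must be depends on [K], the bound [M0 + 1] does not; hence
    it applies to [psi] with every cutoff. *)
Lemma initial_bound (A : set (measurableTypeR R)) w (K : R) : measurable A -> A `<=` D ->
  0 < K -> (forall x, A x -> [/\ 0 <= w x, w x <= K & w x <= 1 + x `^ (4 / 3)]) ->
  \forall t \near 0^'+, \int[mu]_(x in A) (w x * cx (x, t)) <= M0 + 1.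
Proof.
move=> mA AD K0 hw; have iK : 0 < K^-1 by rewrite invr_gt0.
near=> t.
have t0 : 0 < t by near: t; exact: nbhs_right_gt.
have h : (\int[mu]_(x in D) (`|c x t - c0 x|)%:E <= (K^-1)%:E)%E.
  by near: t; exact: initial_L1.
have mc : measurable_fun D (fun x => c x t).
  have := meas_mul_cx H (f := fun=> 1) t0 (fun x _ => @cst_continuous _ _ _ _).
  apply: eq_measurable_fun => x; rewrite in_halfline => x0.
  by rewrite mul1r cxE.
have main : (\int[mu]_(x in A) (w x * cx (x, t))%:E <= (M0 + 1)%:E)%E.
  apply: (@le_trans _ _ (\int[mu]_(x in D)
      (((1 + x `^ (4 / 3)) * c0 x)%:E + K%:E * (`|c x t - c0 x|)%:E))%E).
    apply: ge0_le_integral_sub => // x.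
    - move=> Ax; have [w0 _ _] := hw x Ax.
      by rewrite lee_fin mulr_ge0// (cx_ge0 H).
    - rewrite halflineE => x0; rewrite adde_ge0// ?mule_ge0 ?lee_fin ?(ltW K0)//.
      by rewrite mulr_ge0 ?c0_ge0// addr_ge0// powR_ge0.
    - move=> Ax; have := AD x Ax; rewrite halflineE => x0.
      have [w0 wK w1] := hw x Ax.
      rewrite -EFinM -EFinD lee_fin cxE//.
      have d0 : c x t - c0 x <= `|c x t - c0 x| by exact: ler_norm.
      have n0 : 0 <= `|c x t - c0 x| by [].
      have k1 := ler_wpM2l w0 d0; have k2 := ler_wpM2r n0 wK.
      have k3 := ler_wpM2r (c0_ge0 x0) w1.
      lra.
  rewrite ge0_integralD//; first last.
  - apply/measurable_EFinP; apply: measurable_funM => //.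
    by apply: measurableT_comp => //; exact: measurable_funB.
  - by move=> x _; rewrite mule_ge0// lee_fin// ltW.
  - by apply/measurable_EFinP; exact: meas_1p43.
  - move=> x; rewrite halflineE => x0.
    by rewrite lee_fin mulr_ge0 ?c0_ge0// addr_ge0// powR_ge0.
  rewrite c0_moment ge0_integralZl//; first last.
  - by rewrite lee_fin ltW.
  - apply/measurable_EFinP.
    by apply: measurableT_comp => //; exact: measurable_funB.
  rewrite EFinD leeD2l//.
  apply: (@le_trans _ _ (K%:E * (K^-1)%:E)%E).
    by apply: lee_wpmul2l => //; rewrite lee_fin ltW.
  by rewrite -EFinM divff// gt_eqF.
have nn : (0 <= \int[mu]_(x in A) (w x * cx (x, t))%:E)%E.
  apply: integral_ge0 => x Ax; have [w0 _ _] := hw x Ax.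
  by rewrite lee_fin mulr_ge0// (cx_ge0 H).
rewrite /Rintegral -lee_fin fineK// ge0_fin_numE//.
by apply: le_lt_trans main _; rewrite ltry.
Unshelve. all: by end_near. Qed.

Lemma mass_initial : \forall t \near 0^'+, \int[mu]_(x in D) cx (x, t) <= M0 + 1.
Proof.
have h0 x : D x -> [/\ 0 <= 1 :> R, 1 <= 1 :> R & 1 <= 1 + x `^ (4 / 3)].
  by rewrite halflineE => /le_1p43[].
have := @initial_bound D (fun=> 1) 1 mD (fun _ => id) ltr01 h0.
apply: filterS => t h.
apply: le_trans h; rewrite le_eqVlt; apply/orP; left; apply/eqP.
by apply: eq_Rintegral => x _; rewrite mul1r.
Qed.

Lemma moment_initial n : \forall t \near 0^'+, moment c n t <= M0 + 1.
Proof.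
have N0 := cutoffs_gt0 R n.
apply: (@initial_bound `[0, cutoffs R n]%classic (fun x => psi x * eta (cutoffs R n) x)
  (1 + cutoffs R n * cbrt (cutoffs R n))) => //.
- exact: sub_halfline.
- by rewrite ltr_pwDl// mulr_ge0 ?cbrt_ge0// ltW.
- move=> x /=; rewrite in_itv/= => xN; have /andP[x0 xN'] := xN.
  have /andP[e0 e1] := eta01 N0 xN; have [s0 s1 _] := psi_bounds x0.
  have e2 : psi x * eta (cutoffs R n) x <= psi x by exact: ler_piMr.
  have e3 : x * cbrt x <= cutoffs R n * cbrt (cutoffs R n).
    by apply: ler_pM => //; [exact: cbrt_ge0|exact: ler_cbrt].
  have e4 : x `^ (4 / 3) = x * cbrt x by rewrite powR43// exprSr cbrtK.
  by split; [exact: mulr_ge0|lra|lra].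
Qed.

End initial.

(** * Growth of the integrated energy *)

Lemma nonincreasing_derive (R : realType) (f df : R -> R) (a b : R) : a <= b ->
  (forall x : R, a <= x <= b -> is_derive x (1 : R) f (df x)) ->
  (forall x : R, a <= x <= b -> df x <= 0) -> f b <= f a.
Proof.
rewrite le_eqVlt => /predU1P[->//|ab] h1 h2.
have cf : {within `[a, b], continuous f} by apply: cts_within => x /h1/is_derive_cts.
have h3 x : x \in `]a, b[ -> is_derive x (1 : R) f (df x).
  by rewrite in_itv/= => /andP[? ?]; apply: h1; rewrite !ltW.
have [x + e] := MVT ab h3 cf.
rewrite in_itv/= => /andP[ax xb]; rewrite -subr_le0 e mulr_le0_ge0 ?subr_ge0 ?(ltW ab)//.
by apply: h2; rewrite !ltW.
Qed.

Section growth.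
Variables (R : realType) (eps : R) (c0 L : R -> R) (c : R -> R -> R) (M0 : R).
Hypothesis eps_gt0 : 0 < eps.
Hypothesis eps_le1 : eps <= 1.
Hypothesis H : diffusive_LSW_solution eps c0 L c.
Notation mu := (@lebesgue_measure R).
Notation cx := (cx c).
Notation D := (@halfline R).
Implicit Types (x t k : R).
Hypothesis c0_meas : measurable_fun D c0.
Hypothesis c0_ge0 : forall x, 0 <= x -> 0 <= c0 x.
Hypothesis c0_mass : (\int[mu]_(x in D) (x * c0 x)%:E = 1)%E.
Hypothesis c0_moment : (\int[mu]_(x in D) ((1 + x `^ (4 / 3)) * c0 x)%:E = M0%:E)%E.
Let mD := @measurable_halfline R.

(** The energy decreases, so its values at arbitrarily small times decide; these are bounded by the
    number density, itself at most [M0 + 1]. *)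
Lemma energy_bound k t : 0 < k -> k <= 1 -> 0 < t -> energy c k t <= 3 / 2 * (M0 + 2).
Proof.
move=> k0 k1 t0.
have h := mass_initial H c0_meas c0_ge0 c0_moment.
near (0 : R)^'+ => s.
have s0 : 0 < s by near: s; exact: nbhs_right_gt.
have st : s < t by near: s; exact: nbhs_right_lt.
have hs : \int[mu]_(x in D) cx (x, s) <= M0 + 1 by near: s; exact: h.
apply: (@le_trans _ _ (energy c k s)).
  apply: (nonincreasing_derive (ltW st)
    (df := fun t => - total_dissipation eps L c k t)).
    move=> x /andP[sx _]; apply: (energy_derive eps_gt0 eps_le1 H k0).
    exact: lt_le_trans sx.
  move=> x /andP[sx _]; rewrite oppr_le0.
  by apply: (total_dissipation_ge0 eps_gt0 eps_le1 H k0); exact: lt_le_trans sx.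
by apply: le_trans (energy_le H k0 s0) _; lra.
Unshelve. all: by end_near. Qed.

Section horizon.
Variables (k T : R).
Hypothesis k_gt0 : 0 < k.
Hypothesis k_le1 : k <= 1.
Hypothesis k_leL : forall t, 0 < t <= T -> k <= L t.
Notation E := (energy c k).
Notation TD := (total_dissipation eps L c k).

(** Time 0 is left out because continuity and bounds of the energy are established only for positive
    times. *)
Definition cumul t := \int[mu]_(s in `]0, t]) (E s ^+ 2).

Lemma cts_energy t : 0 < t -> {for t, continuous E}.
Proof. by move=> t0; apply: is_derive_cts (energy_derive eps_gt0 eps_le1 H k_gt0 t0). Qed.

Lemma energy_ge0 t : 0 < t -> 0 <= E t.
Proof. by move=> t0; rewrite ltW// (energy_gt0 H k_gt0 k_le1). Qed.

Lemma energy_sqr_integrable t :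
  mu.-integrable `]0, t]%classic (EFin \o (fun s => E s ^+ 2)).
Proof.
have m0t : measurable (`]0, t]%classic : set (measurableTypeR R)) by exact: measurable_itv.
have [t0|t0] := leP t 0.
  rewrite set_itv_ge; first exact: integrable_set0.
  by rewrite bnd_simp -leNgt.
apply: (@integrable_dominated _ _ _ (fun=> (3 / 2 * (M0 + 2)) ^+ 2)) => //.
- have : measurable_fun (`]0, +oo[%classic : set R) (fun s => E s ^+ 2).
    apply: open_continuous_measurable_fun; first exact: interval_open.
    move=> s; rewrite inE/= in_itv/= andbT => s0.
    exact: (cvgM (cts_energy s0) (cts_energy s0)).
  apply: measurable_funS => //.
    by move=> s /=; rewrite !in_itv/= andbT => /andP[].
- have : mu.-integrable `[0, t]%classic (EFin \o (fun=> (3 / 2 * (M0 + 2)) ^+ 2 : R)).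
    by apply: cts_integrable => x _; exact: cst_continuous.
  apply: integrableS => //; exact: subset_itv_oc_cc.
- move=> s /=; rewrite in_itv/= => /andP[s0 _].
  rewrite ger0_norm ?sqr_ge0// lerXn2r ?nnegrE ?energy_ge0//.
    by apply: le_trans (energy_ge0 s0) _; exact: energy_bound.
  exact: energy_bound.
Qed.

Lemma cumul_derive t : 0 < t -> is_derive t (1 : R) cumul (E t ^+ 2).
Proof.
move=> t0; have ti : t < t + 1 by rewrite ltrDl.
have ce : {for t, continuous (fun s => E s ^+ 2)}.
  exact: (cvgM (cts_energy t0) (cts_energy t0)).
have := @continuous_FTC1 R (fun s => E s ^+ 2) (BRight 0) t (t + 1) ti
  (energy_sqr_integrable (t + 1)).
have ax : (BRight 0 < BRight t :> itv_bound R)%O by rewrite bnd_simp.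
move=> /(_ ax ce) [h1 h2].
by apply: DeriveDef; [exact: h1|rewrite -derive1E].
Qed.

Lemma cumul_ge0 t : 0 <= cumul t.
Proof. by apply: Rintegral_ge0 => s _; exact: sqr_ge0. Qed.

(* The functional [M + 3E - 1/(4E) - 16 int E^2] is nonincreasing up to the cutoff error. *)
Lemma functional_le n s t : 0 < s -> s <= t -> t <= T ->
  moment c n t - (4 * E t)^-1 - 16 * cumul t - 6 / n.+1%:R * t <=
  moment c n s + 3 * E s.
Proof.
move=> s0 st tT.
(* The linear term [err * u] in [F] compensates the cutoff error in the derivative of the moment. *)
pose err : R := 6 / n.+1%:R.
have err0 : 0 <= err by rewrite divr_ge0// ler0n.
pose F u := moment c n u + 3 * E u - (4 * E u)^-1 - 16 * cumul u - err * u.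
have key u : s <= u <= t -> exists2 d, is_derive u (1 : R) F d & d <= 0.
  move=> /andP[su ut]; have u0 : 0 < u by exact: lt_le_trans su.
  have Eu := energy_gt0 H k_gt0 k_le1 u0.
  have [dM hM hMle] := moment_derive eps_gt0 eps_le1 H k_gt0 k_le1 n u0.
  have kL : k <= L u by apply: k_leL; rewrite u0 (le_trans ut).
  have {}hMle := hMle kL (E u) Eu.
  have hE := energy_derive eps_gt0 eps_le1 H k_gt0 u0.
  have h4 := der_mul (der_cst 4 u erefl) hE erefl.
  have h4n : 4 * E u != 0 by rewrite mulf_neq0// gt_eqF.
  exists (dM - (3 + (4 * E u ^+ 2)^-1) * TD u - 16 * E u ^+ 2 - err).
    apply: der_sub (der_sub (der_sub (der_add hM (der_mul (der_cst 3 u erefl) hE erefl) erefl)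
      (der_inv (f := fun y => 4 * E y) h4n h4 erefl) erefl)
      (der_mul (der_cst 16 u erefl) (cumul_derive u0) erefl) erefl)
      (der_mul (der_cst err u erefl) (der_id u erefl) erefl) _.
    by field; rewrite gt_eqF.
  by rewrite -/err in hMle; lra.
have dF u : s <= u <= t -> is_derive u (1 : R) F (derive1 F u).
  by move=> /key[d h _]; apply: derivable_derive1; case: h.
have dF0 u : s <= u <= t -> derive1 F u <= 0.
  by move=> /key[d [h1 h2] d0]; rewrite derive1E h2.
have := nonincreasing_derive st dF dF0; rewrite /F => h.
have t0 : 0 < t by exact: lt_le_trans st.
have e1 := energy_ge0 t0.
have e2 : 0 <= (4 * E s)^-1 by rewrite invr_ge0 mulr_ge0// energy_ge0.
have e3 := cumul_ge0 s.
have e4 : 0 <= err * s by rewrite mulr_ge0// ltW.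
by rewrite -/err; lra.
Qed.

(** For fixed [n] the initial time s tends to 0 first, because the smallness required of s depends
    on [n]; only then n -> oo. The remaining quarter of the mass gives 1/(4E) <= 17 (M0 + int E^2),
    and 68 = 4 * 17. *)
Lemma energy_lower t : 0 < t <= T -> 1 <= 68 * (M0 + cumul t) * E t.
Proof.
move=> /andP[t0 tT]; have Et := energy_gt0 H k_gt0 k_le1 t0.
have M1 := M0_ge1 c0_ge0 c0_mass c0_moment.
(* 3/4 is the sum of 1/2 from the interpolation and 1/4 from the term 1/(4E). The initial data
   contribute 1 + (M0 + 1) + 9/2 (M0 + 2), which is at most 17 M0 as [M0 >= 1]. *)
have step n : (cut_mass c n t - 3 / 4) / E t - 6 / n.+1%:R * t <= 17 * M0 + 16 * cumul t.
  near (0 : R)^'+ => s.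
  have s0 : 0 < s by near: s; exact: nbhs_right_gt.
  have st : s <= t by near: s; exact: nbhs_right_le.
  have hs : moment c n s <= M0 + 1.
    by near: s; exact: (moment_initial H c0_meas c0_ge0 c0_moment).
  have h1 := functional_le n s0 st tT.
  have h2 := energy_bound k_gt0 k_le1 s0.
  have h3 := cut_mass_le H k_gt0 k_le1 n t0.
  have h4 : (cut_mass c n t - 1 / 2) / E t <= 1 + moment c n t.
    by rewrite ler_pdivrMr//; lra.
  have -> : (cut_mass c n t - 3 / 4) / E t =
      (cut_mass c n t - 1 / 2) / E t - (4 * E t)^-1 by field; rewrite gt_eqF.
  move: ((_ - 1 / 2) / E t) h4 (_^-1) (6 / _ * t) h1 => p h4 q r h1.
  by lra.
have cv : (cut_mass c n t - 3 / 4) / E t - 6 / n.+1%:R * t @[n --> \oo] -->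
    (1 - 3 / 4) / E t - 0.
  apply: cvgB.
    apply: cvgM; last exact: cvg_cst.
    by apply: cvgB; [exact: cut_mass_cvg H _ t0|exact: cvg_cst].
  rewrite (_ : 0 = 6 * 0 * t); last by rewrite mulr0 mul0r.
  apply: cvgM; last exact: cvg_cst.
  by apply: cvgM; [exact: cvg_cst|exact: cvg_harmonic].
have lim : (1 - 3 / 4) / E t - 0 <= 17 * M0 + 16 * cumul t.
  by apply: (cvgr_to_le cv); near=> n; exact: step.
rewrite subr0 ler_pdivrMr// in lim.
have hE : 0 <= cumul t * E t by rewrite mulr_ge0 ?cumul_ge0// ltW.
by lra.
Unshelve. all: by end_near. Qed.

(** By [energy_lower] the cube of [y] grows at least at the rate [a]. Integration starts at T/2,
    inside the range where [cumul] is differentiable, and yields y(T)^3 >= a T / 2 >= T / 16^3. The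
    hypothesis on [T] makes [M0] at most half of the resulting bound on [y T]. *)
Lemma cumul_lower : 0 < T -> 32 ^+ 3 * M0 ^+ 3 <= T -> cbrt T / 32 <= cumul T.
Proof.
move=> T0 KT.
have M1 := M0_ge1 c0_ge0 c0_mass c0_moment.
pose y t := M0 + cumul t.
have y1 t : 1 <= y t by rewrite /y; have := cumul_ge0 t; lra.
pose a : R := 3 / 68 ^+ 2.
pose F t := a * t - y t ^+ 3.
have T2 : T / 2 <= T by lra.
have hF := @nonincreasing_derive R F (fun t => a - 3 * y t ^+ 2 * E t ^+ 2) _ _ T2.
have : F T <= F (T / 2).
  apply: hF => t /andP[t1 t2]; have t0 : 0 < t by lra.
    have dy : is_derive t (1 : R) y (E t ^+ 2).
      by apply: der_add (der_cst M0 t erefl) (cumul_derive t0) _; rewrite add0r.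
    apply: der_sub (der_mul (der_cst a t erefl) (der_id t erefl) erefl) (der_exp dy erefl) _.
    by rewrite mul0r mulr1 add0r.
  have h : 1 <= 68 * y t * E t by apply: energy_lower; rewrite t0.
  have : 1 <= (68 * y t * E t) ^+ 2 by rewrite exprn_ege1.
  rewrite !exprMn /a; set z := y t ^+ 2 * E t ^+ 2 => h2.
  have -> : 3 * y t ^+ 2 * E t ^+ 2 = 3 * z by rewrite /z; ring.
  have : 1 <= 68 ^+ 2 * z by rewrite /z mulrA.
  by rewrite -ler_pdivrMl; lra.
rewrite /F => h.
have y3 : 0 <= y (T / 2) ^+ 3 by rewrite exprn_ge0//; have := y1 (T / 2); lra.
have yT : T / 16 ^+ 3 <= y T ^+ 3 by rewrite /a in h; lra.
have q0 := cbrt_gt0 T0.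
have qT : cbrt T ^+ 3 = T by rewrite cbrtK// ltW.
have y2 : cbrt T / 16 <= y T.
  apply: ler_cube; first by have := y1 T; lra.
  by rewrite expr_div_n qT.
have M2 : M0 <= cbrt T / 32.
  apply: ler_cube; first by rewrite divr_ge0// ltW.
  by rewrite expr_div_n qT ler_pdivlMr; lra.
by rewrite /y in y2; lra.
Qed.

End horizon.

End growth.

(** * From the shifted energy to the mean square energy *)

Section mean_square.
Variables (R : realType) (eps : R) (c0 L : R -> R) (c : R -> R -> R) (M0 : R).
Hypothesis eps_gt0 : 0 < eps.
Hypothesis eps_le1 : eps <= 1.
Hypothesis H : diffusive_LSW_solution eps c0 L c.
Notation mu := (@lebesgue_measure R).
Notation cx := (cx c).
Notation D := (@halfline R).
Implicit Types (x t k : R).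
Hypothesis c0_meas : measurable_fun D c0.
Hypothesis c0_ge0 : forall x, 0 <= x -> 0 <= c0 x.
Hypothesis c0_mass : (\int[mu]_(x in D) (x * c0 x)%:E = 1)%E.
Hypothesis c0_moment : (\int[mu]_(x in D) ((1 + x `^ (4 / 3)) * c0 x)%:E = M0%:E)%E.
Let mD := @measurable_halfline R.

Lemma LSW_energyE t : 0 <= t ->
  LSW_energy c t = (\int[mu]_(x in D) (cbrt x ^+ 2 * c x t)%:E)%E.
Proof.
by move=> t0; apply: eq_integral => x; rewrite in_halfline => x0; rewrite powR23.
Qed.

Lemma LSW_energy_ge0 t : 0 <= t -> (0 <= LSW_energy c t)%E.
Proof.
move=> t0; apply: integral_ge0 => x /=; rewrite in_itv/= andbT => x0.
by rewrite lee_fin mulr_ge0 ?powR_ge0// (LSW_c_ge0 H).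
Qed.

Lemma LSW_energy_ge k t : 0 < k -> k <= 1 -> 0 < t ->
  ((2 / 3 * energy c k t)%:E <= LSW_energy c t)%E.
Proof.
move=> k0 k1 t0; have ei := energy_integrable H k0 t0.
rewrite /energy -RintegralZl//.
have ei' := integrableZl mD (2 / 3) ei.
rewrite /Rintegral fineK; last exact: (integrable_fin_num mD ei').
rewrite LSW_energyE ?(ltW t0)//; apply: ge0_le_integral_sub => // x; rewrite ?halflineE => x0.
- by rewrite lee_fin mulr_ge0// mulr_ge0 ?phi_ge0// (cx_ge0 H).
- by rewrite lee_fin mulr_ge0 ?sqr_ge0// (LSW_c_ge0 H)// ltW.
- rewrite lee_fin cxE// mulrA ler_wpM2r ?(LSW_c_ge0 H) ?(ltW t0)//.
  by have := phi_le_sqr k0 x0; lra.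
Qed.

(** For any shift [k], x^(2/3) <= (k + x)^(2/3) = 2/3 phi_k(x) + k^(2/3). The first part costs at
    most [M0 + 2]; the shift is then taken so small, depending on [t], that k^(2/3) times the number
    density is at most 1. Time 0 is read off from [c0] directly. *)
Lemma LSW_energy_bound t : 0 <= t -> (LSW_energy c t <= (M0 + 3)%:E)%E.
Proof.
rewrite le_eqVlt => /predU1P[<-|t0].
  apply: (@le_trans _ _ M0%:E); last by rewrite lee_fin lerDl.
  rewrite LSW_energyE// -c0_moment; apply: ge0_le_integral_sub => // x; rewrite halflineE => x0.
  - by rewrite lee_fin mulr_ge0 ?sqr_ge0// (LSW_c_ge0 H).
  - by rewrite lee_fin mulr_ge0 ?c0_ge0// addr_ge0// powR_ge0.
  - have [_ h _ _] := le_1p43 x0.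
    by rewrite (LSW_initial H)// -powR23// lee_fin ler_wpM2r// c0_ge0.
have zi : mu.-integrable D (EFin \o (fun x => 1 * cx (x, t))).
  apply: (integrable_lin H t0 (fun x _ => @cst_continuous _ _ _ _) ler01) => x x0.
  by rewrite normr1; lra.
set Z := \int[mu]_(x in D) (1 * cx (x, t)).
have Z0 : 0 <= Z by apply: Rintegral_ge0 => x _; rewrite mul1r (cx_ge0 H).
(* [d] is the cube root of the shift, chosen so that [d ^+ 2 * Z <= 1]. *)
pose d := (1 + Z)^-1; have d0 : 0 < d by rewrite invr_gt0; lra.
have dZ : d * (1 + Z) = 1 by rewrite mulVf// gt_eqF//; lra.
have d1 : d <= 1 by rewrite invf_le1; lra.
have [k0 k1] : 0 < d ^+ 3 /\ d ^+ 3 <= 1 by rewrite exprn_gt0// exprn_ile1// ltW.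
have cd : cbrt (d ^+ 3) = d by apply: cbrt_uniq => //; exact: ltW.
have ei := energy_integrable H k0 t0.
have ei' := integrableZl mD (2 / 3) ei.
have zi' := integrableZl mD (d ^+ 2) zi.
have si := integrableD mD ei' zi'.
apply: (@le_trans _ _ (2 / 3 * energy c (d ^+ 3) t + d ^+ 2 * Z)%:E); last first.
  have := energy_bound eps_gt0 eps_le1 H c0_meas c0_ge0 c0_moment k0 k1 t0.
  have : d ^+ 2 * Z <= 1.
    have dZ1 : d * Z <= 1 by lra.
    by rewrite expr2 -mulrA mulr_ile1// ?mulr_ge0// ltW.
  by rewrite lee_fin; lra.
have -> : 2 / 3 * energy c (d ^+ 3) t + d ^+ 2 * Z =
    \int[mu]_(x in D) (2 / 3 * (phi (d ^+ 3) x * cx (x, t)) + d ^+ 2 * (1 * cx (x, t))).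
  by rewrite RintegralD// RintegralZl// RintegralZl.
rewrite /Rintegral fineK; last exact: (integrable_fin_num mD si).
rewrite LSW_energyE ?(ltW t0)//; apply: ge0_le_integral_sub => // x; rewrite halflineE => x0.
- by rewrite lee_fin mulr_ge0 ?sqr_ge0// (LSW_c_ge0 H)// ltW.
- have c_ge0 := cx_ge0 H x t0; have p_ge0 := phi_ge0 k0 x0.
  rewrite lee_fin mul1r addr_ge0//; first by rewrite mulr_ge0// mulr_ge0.
  by rewrite mulr_ge0// sqr_ge0.
- have h : cbrt x ^+ 2 <= cbrt (d ^+ 3 + x) ^+ 2.
    by rewrite lerXn2r// ?nnegrE ?cbrt_ge0// ler_cbrt// lerDr ltW.
  rewrite lee_fin cxE// mul1r mulrA -mulrDl ler_wpM2r ?(LSW_c_ge0 H) ?(ltW t0)//.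
  by rewrite /phi cd; lra.
Qed.

Lemma mean_square_lt_pinfty T : 0 < T -> (LSW_mean_square_energy c T < +oo)%E.
Proof.
move=> T0; rewrite /LSW_mean_square_energy lte_mul_pinfty ?lee_fin ?invr_ge0 ?(ltW T0)//.
apply: (@le_lt_trans _ _ (\int[mu]_(t in `[0%R, T]) ((M0 + 3) ^+ 2)%:E)%E).
  apply: ge0_le_integral_sub => // t /=; rewrite in_itv/= => /andP[t0 _].
  - by rewrite mule_ge0// LSW_energy_ge0.
  - by rewrite lee_fin sqr_ge0.
  - rewrite expr2 EFinM.
    by apply: lee_pmul; rewrite ?LSW_energy_ge0 ?LSW_energy_bound.
by rewrite integral_cst//= lebesgue_measure_itv/= lte_fin T0 -EFinD -EFinM ltry.
Qed.

(** The positive continuous [L] has a positive minimum on [0, T], from which an admissible shift [k]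
    is taken; the resulting bound no longer sees it. *)
Lemma mean_square_ge T : 32 ^+ 3 * M0 ^+ 3 <= T ->
  (((72 * cbrt T ^+ 2)^-1)%:E <= LSW_mean_square_energy c T)%E.
Proof.
move=> KT; have M1 := M0_ge1 c0_ge0 c0_mass c0_moment.
have T0 : 0 < T.
  by apply: lt_le_trans KT; rewrite mulr_gt0// exprn_gt0//; lra.
have [s sT sL] : exists2 s, s \in `[0, T] & forall t, t \in `[0, T] -> L s <= L t.
  apply: EVT_min; first exact: ltW.
  apply: continuous_subspaceW (LSW_L_continuous H) => x /=.
  by rewrite !in_itv/= andbT => /andP[].
have Ls : 0 < L s by apply: (LSW_L_gt0 H); move: sT; rewrite in_itv/= => /andP[].
pose k := Num.min 1 (L s).
have k0 : 0 < k by rewrite lt_min ltr01.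
have k1 : k <= 1 by rewrite ge_min lexx.
have kL t : 0 < t <= T -> k <= L t.
  by move=> /andP[t0 tT]; rewrite ge_min sL ?orbT// in_itv/= ltW.
have hT := cumul_lower eps_gt0 eps_le1 H c0_meas c0_ge0 c0_mass c0_moment k0 k1 kL T0 KT.
have q0 := cbrt_gt0 T0; have qT : cbrt T ^+ 3 = T by rewrite cbrtK// ltW.
have hi := energy_sqr_integrable eps_gt0 eps_le1 H c0_meas c0_ge0 c0_moment k0 k1 T.
have mI : measurable (`]0, T]%classic : set (measurableTypeR R)) by exact: measurable_itv.
have hi' := integrableZl mI (4 / 9) hi.
apply: (@le_trans _ _ ((T^-1)%:E * (4 / 9 * cumul c k T)%:E)%E).
  rewrite -EFinM lee_fin.
  (* 72 is 32 * 9/4, where 4/9 is the square of the factor 2/3 in [LSW_energy_ge]. *)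
  rewrite (_ : (72 * _)^-1 = T^-1 * (4 / 9 * (cbrt T / 32))).
    by rewrite ler_wpM2l ?invr_ge0 ?(ltW T0)// ler_wpM2l.
  by rewrite -{2}qT; field; rewrite gt_eqF.
apply: lee_wpmul2l; first by rewrite lee_fin invr_ge0 ltW.
rewrite /cumul -RintegralZl// /Rintegral fineK; last exact: (integrable_fin_num mI hi').
apply: ge0_le_integral_sub.
- exact: subset_itv_oc_cc.
- by move=> t _; rewrite lee_fin mulr_ge0// sqr_ge0.
- move=> t /=; rewrite in_itv/= => /andP[t0 _].
  by rewrite mule_ge0// LSW_energy_ge0.
- move=> t; rewrite /= in_itv/= => /andP[t0 _].
  rewrite (_ : 4 / 9 * _ = (2 / 3 * energy c k t) ^+ 2); last by field.
  have e0 : 0 <= 2 / 3 * energy c k t by rewrite mulr_ge0// ltW// (energy_gt0 H k0 k1).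
  rewrite expr2 EFinM.
  by apply: lee_pmul; rewrite ?lee_fin// LSW_energy_ge.
Qed.

End mean_square.

(* The mean square energy is [\bar R]-valued and [powR] sends [0] to [0]: the
   first two conjuncts say that the negative power is taken of a positive real. *)
Theorem theorem3p2 (R : realType) :
  exists K1 K2 : R, [/\ 0 < K1, 0 < K2 &
    forall (c0 : R -> R) (M0 : R),
      measurable_fun `[(0 : R), +oo[ c0 ->
      (forall x : R, 0 <= x -> 0 <= c0 x) ->
      (\int[lebesgue_measure]_(x in `[0%R, +oo[) (x * c0 x)%:E = 1)%E ->
      (\int[lebesgue_measure]_(x in `[0%R, +oo[)
          ((1 + x `^ (4 / 3)) * c0 x)%:E = M0%:E)%E ->
    forall (eps : R) (L : R -> R) (c : R -> R -> R),
      0 < eps -> eps <= 1 ->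
      diffusive_LSW_solution eps c0 L c ->
    forall T : R, K2 * M0 ^+ 3 <= T ->
      [/\ (0 < LSW_mean_square_energy c T)%E,
          (LSW_mean_square_energy c T < +oo)%E &
          (fine (LSW_mean_square_energy c T)) `^ (- (3 / 2)) <= K1 * T]].
Proof.
(* [K1] arises from raising [72 * cbrt T ^+ 2] to the power 3/2, and [K2] is the threshold of
   [cumul_lower]. *)
exists (72 `^ (3 / 2)), (32 ^+ 3); split; [exact: powR_gt0|by rewrite exprn_gt0|].
move=> c0 M0 c0_meas c0_ge0 c0_mass c0_moment eps L c eps_gt0 eps_le1 H T KT.
have M1 := M0_ge1 c0_ge0 c0_mass c0_moment.
have T0 : 0 < T.
  by apply: lt_le_trans KT; rewrite mulr_gt0// exprn_gt0//; lra.
have q0 := cbrt_gt0 T0; have qT : cbrt T ^+ 3 = T by rewrite cbrtK// ltW.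
have lo := mean_square_ge eps_gt0 eps_le1 H c0_meas c0_ge0 c0_mass c0_moment KT.
have hi := mean_square_lt_pinfty eps_gt0 eps_le1 H c0_meas c0_ge0 c0_moment T0.
have p0 : 0 < 72 * cbrt T ^+ 2 by rewrite mulr_gt0// exprn_gt0.
have mse0 : (0 < LSW_mean_square_energy c T)%E.
  by apply: lt_le_trans lo; rewrite lte_fin invr_gt0.
split=> //.
have fn : LSW_mean_square_energy c T \is a fin_num by rewrite ge0_fin_numE// ltW.
move: lo mse0; rewrite -(fineK fn) lee_fin lte_fin /=.
move: (fine _) => v lo v0.
rewrite powRN -powR_inv1 ?powR_ge0// -powRrM mulrC powRrM powR_inv1 ?(ltW v0)//.
apply: (@le_trans _ _ ((72 * cbrt T ^+ 2) `^ (3 / 2))).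
  apply: ge0_ler_powR; rewrite ?nnegrE ?invr_ge0 ?(ltW v0) ?(ltW p0)//.
  by rewrite -[leRHS]invrK lef_pV2 ?posrE ?invr_gt0.
rewrite powRM// ?sqr_ge0// ler_wpM2l ?powR_ge0//.
rewrite -powR_mulrn ?(ltW q0)// -powRrM.
rewrite (_ : 2%:R * (3 / 2) = 3%:R); last by field.
by rewrite powR_mulrn ?qT// ltW.
Qed.
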